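(* Let $v\in(0,1]$ and $u,x\in\mathbb{N}^+$. Let $\mathbf{H}^{(v)}(x,\tau_0;u)$ be the $N\times N$ matrix with $(i,j)$-th element the $v$-potential function $$H^{(v)}_{ij}(x,\tau_0;u)=\sum_{n=0}^\infty v^n\,\mathbb{P}\left(U_n=x,\,J_n=j,\,n<\tau_0\mid J_0=i,\,U_0=u\right),\qquad i,j\in E.$$ Then $$\mathbf{H}^{(v)}(x,\tau_0;u)=\mathbf{W}_v(u)\,\mathbf{R}_v^{x}-\mathbf{W}_v(u-x),$$ where $\mathbf{R}_v$ is the left solution of $\mathbf{F}(\cdot)=v^{-1}\mathbf{I}$.
   Context: $\mathbb{N}=\{0,1,2,\dots\}$, $\mathbb{N}^+=\{1,2,\dots\}$, $E=\{1,\dots,N\}$. Risk process: $U_n=u+n-\sum_{i=1}^n Z_i$, with $U_0=u$ and $\mathbb{N}$-valued claims $Z_k$. The phase process $\{J_n\}_{n\in\mathbb{N}}$ is a homogeneous Markov chain on $E$, irreducible and positive recurrent with stationary distribution $\boldsymbol{\pi}$. Given the past up to time $k-1$ and $J_{k-1}=i$, $(Z_k,J_k)$ has law $\lambda_{ij}(m)=\mathbb{P}(Z_1=m,J_1=j\mid J_0=i)$, $m=0,1,2,\dots$, with $\mathbb{E}(Z_1\mathbb{I}_{(J_1=j)}\mid J_0=i)<\infty$. Write $(\mathbf{\Lambda}(m))_{ij}=\lambda_{ij}(m)$. Thus $(U,J)$ is an upward skip-free Markov additive chain (MAC) with increment matrices $\mathbf{A}_m=\mathbf{\Lambda}(1-m)$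 for $m\le1$ and $\mathbf{A}_m=\mathbf{0}$ for $m\ge2$. It is assumed that $\mathbf{A}_1$ is non-singular and that the net profit condition $\boldsymbol{\pi}^\top\sum_{m\ge-1}m\mathbf{A}_{-m}\boldsymbol{e}<0$ holds ($\boldsymbol{e}$ = column of ones). Ruin time: $\tau_0=\inf\{n\in\mathbb{N}:U_n\le0\}$ ($\inf\emptyset=\infty$). Let $\mathbf{F}(z)=\sum_{m=-1}^\infty z^m\mathbf{A}_{-m}$. Scale matrix: $\mathbf{W}_v(n)=\mathbf{0}$ for integers $n\le0$, and $\mathbf{W}_v(n)$, $n\ge1$, is determined by $$\sum_{n=0}^\infty z^n\mathbf{W}_v(n)=\left(v\mathbf{F}(z)-\mathbf{I}\right)^{-1},$$ i.e. by expanding the right-hand side as a power series in $z$ and matching coefficients. (Known facts: $\mathbf{W}_v(n)$ is invertible for $n\ge1$. If $X$ is the level process of the MAC, $\mathbf{G}_v$ is the matrix with entries $\mathbb{E}(v^{\tau_1^+}\mathbb{I}_{(\tau_1^+<\infty,\,J_{\tau_1^+}=j)}\mid X_0=0,J_0=i)$, and $\tau_n^+=\inf\{k\ge0:X_k\ge n\}$, then $\mathbf{W}_v(n)=\mathbf{G}_v^{-n}\mathbf{L}_v^+(n)$, where $(\mathbf{L}_v^+(n))_{ij}=\mathbb{E}(\sum_{0\le k<\tau_n^+}v^k\mathbb{I}_{(X_k=0,J_k=j)}\mid X_0=0,J_0=i)$.) The matrix $\mathbf{R}_v$: let $(\widetilde X,\widetilde J)$ be the time-reversed MAC, i.e. the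 MAC with $\widetilde X_0=0$ and increment matrices $\widetilde{\mathbf{A}}_m=\mathrm{diag}(\boldsymbol{\pi})^{-1}\mathbf{A}_m^\top\mathrm{diag}(\boldsymbol{\pi})$. Let $\widetilde\tau_1^+=\inf\{n\in\mathbb{N}:\widetilde X_n\ge1\}$ and $(\widetilde{\mathbf{G}}_v)_{ij}=\mathbb{E}(v^{\widetilde\tau_1^+}\mathbb{I}_{(\widetilde\tau_1^+<\infty,\,\widetilde J_{\widetilde\tau_1^+}=j)}\mid\widetilde J_0=i)$. Then $\mathbf{R}_v:=\mathrm{diag}(\boldsymbol{\pi})^{-1}\widetilde{\mathbf{G}}_v^\top\mathrm{diag}(\boldsymbol{\pi})$; it is the left solution of $\mathbf{F}(\cdot)=v^{-1}\mathbf{I}$, meaning $\sum_{m=-1}^\infty\mathbf{R}_v^m\mathbf{A}_{-m}=v^{-1}\mathbf{I}$. *)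

(* Defs.v *)
From HB Require Import structures.
From mathcomp Require Import all_boot all_order all_algebra.
From mathcomp Require Import all_classical all_reals all_analysis.

Set Implicit Arguments.
Unset Strict Implicit.
Unset Printing Implicit Defensive.

Import Order.TTheory GRing.Theory Num.Theory.
Import numFieldNormedType.Exports.

Local Open Scope classical_set_scope.
Local Open Scope ring_scope.

Section MatrixSeries.
Context {R : realType} {N : nat}.
Implicit Types (f : nat -> 'M[R]_N) (S : 'M[R]_N).

Definition mx_series_cvg f S : Prop :=
  forall i j, series (fun k => f k i j) @ \oo --> S i j.

(* Meaningful only when all the entry series converge. *)
Definition mx_series f : 'M[R]_N :=
  \matrix_(i, j) limn (series (fun k => f k i j)).

End MatrixSeries.

Section Phase.
Context {R : realType} {N : nat}.
Implicit Types (P : 'M[R]_N) (pi : 'rV[R]_N) (Lam : nat -> 'M[R]_N).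

Definition claim_kernel Lam : Prop :=
  (forall m i j, 0 <= Lam m i j) /\
  (forall i, series (fun m => \sum_j Lam m i j) @ \oo --> (1 : R)).

Definition irreducible_mx P : Prop := forall i j, exists n, 0 < (P ^+ n) i j.

Definition stationary_distribution P pi : Prop :=
  [/\ forall i, 0 <= pi 0 i, \sum_i pi 0 i = 1 & pi *m P = pi].

End Phase.

Section IncrementMatrices.
Context {R : realType} {N : nat}.
Implicit Types (A : int -> 'M[R]_N) (pi : 'rV[R]_N).

Definition increment (Lam : nat -> 'M[R]_N) (m : int) : 'M[R]_N :=
  if m <= 1 then Lam `|1 - m|%N else 0.

Definition reversed_increment A pi (m : int) : 'M[R]_N :=
  invmx (diag_mx pi) *m (A m)^T *m diag_mx pi.

(* Sums over m >= -1 are indexed by k = m + 1 in nat. *)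
Definition net_profit A pi : Prop :=
  (pi *m mx_series (fun k : nat => (k%:Z - 1)%:~R *: A (- (k%:Z - 1)))
      *m const_mx 1 : 'M[R]_1) 0 0 < 0.

Definition genfun A (z : R) : 'M[R]_N :=
  mx_series (fun k : nat => z ^ (k%:Z - 1) *: A (- (k%:Z - 1))).

(* F has a pole at 0, so the expansion of (v F(z) - I)^-1 is required on a
   punctured neighbourhood of 0; this determines W (n) for every n. *)
Definition is_scale_matrix A (v : R) (W : int -> 'M[R]_N) : Prop :=
  (forall n : int, n <= 0 -> W n = 0) /\
  (\forall z \near 0^',
     v *: genfun A z - 1%:M \in unitmx /\
     mx_series_cvg (fun n : nat => z ^+ n *: W n%:Z)
                   (invmx (v *: genfun A z - 1%:M))).

(* M ^ (k - 1), with an actual inverse for k = 0. *)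
Definition mx_pow_pred (M : 'M[R]_N) (k : nat) : 'M[R]_N :=
  if k is k'.+1 then M ^+ k' else invmx M.

Definition is_left_solution A (v : R) (M : 'M[R]_N) : Prop :=
  M \in unitmx /\
  mx_series_cvg (fun k : nat => mx_pow_pred M k *m A (- (k%:Z - 1))) (v^-1)%:M.

End IncrementMatrices.

(* [None] is the value +oo, i.e. the infimum of the empty set. *)
Definition first_time (S : pred nat) : option nat :=
  if pselect (exists n, S n) is left h then Some (ex_minn h) else None.

Definition before (n : nat) (t : option nat) : bool :=
  if t is Some m then (n < m)%N else true.

Section Processes.
Context {R : realType} {N : nat} {d : measure_display} {T : measurableType d}.
Implicit Types (P : 'I_N -> probability T R) (J : nat -> T -> 'I_N).

Definition history (V : countType) (xi : nat -> T -> V) J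
    (x : nat -> V) (s : nat -> 'I_N) (n : nat) : set T :=
  [set w | (forall k, (k <= n)%N -> J k w = s k) /\
           (forall k, (0 < k <= n)%N -> xi k w = x k)].

(* P i is the conditional law given J_0 = i.  The last clause says that, given
   the past up to time n, (xi_(n+1), J_(n+1)) has law K _ (J_n) _, multiplied
   out so as to cover pasts of probability zero.  The variable xi_0 plays no
   role. *)
Definition modulated_sequence (V : countType) (K : V -> 'M[R]_N) P
    (xi : nat -> T -> V) J : Prop :=
  [/\ forall n a, measurable (xi n.+1 @^-1` [set a]),
      forall n j, measurable (J n @^-1` [set j]),
      forall i, P i (J 0%N @^-1` [set i]) = 1%E &
      forall i n (x : nat -> V) (s : nat -> 'I_N),
        P i (history xi J x s n.+1) =
        (P i (history xi J x s n) * (K (x n.+1) (s n) (s n.+1))%:E)%E].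

Definition markov_additive_chain (A : int -> 'M[R]_N) P
    (X : nat -> T -> int) J : Prop :=
  (forall w, X 0%N w = 0) /\
  modulated_sequence A P (fun n w => X n w - X n.-1 w) J.

Definition finite_mean_claims P (Z : nat -> T -> nat) J : Prop :=
  forall i j,
    ('E_(P i)[(fun w => (Z 1%N w)%:R * (J 1%N w == j)%:R)%R] < +oo)%E.

Definition surplus (u : nat) (Z : nat -> T -> nat) (n : nat) (w : T) : int :=
  u%:Z + n%:Z - \sum_(1 <= k < n.+1) (Z k w)%:Z.

Definition ruin_time (u : nat) (Z : nat -> T -> nat) (w : T) : option nat :=
  first_time (fun n => surplus u Z n w <= 0).

Definition potential P (Z : nat -> T -> nat) J (v : R) (u x : nat)
    : 'M[\bar R]_N :=
  \matrix_(i, j)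
    (\sum_(0 <= n <oo)
       (v ^+ n)%R%:E *
       P i [set w | [/\ surplus u Z n w = x%:Z, J n w = j &
                        before n (ruin_time u Z w)]])%E.

Definition passage_time (X : nat -> T -> int) (w : T) : option nat :=
  first_time (fun n => 1 <= X n w).

Definition passage_matrix P (X : nat -> T -> int) J (v : R) : 'M[R]_N :=
  \matrix_(i, j)
    fine ('E_(P i)[(fun w => if passage_time X w is Some n
                             then v ^+ n * (J n w == j)%:R else 0)%R])%E.

(* To be applied to the time-reversed chain. *)
Definition R_matrix (pi : 'rV[R]_N) P (X : nat -> T -> int) J (v : R)
    : 'M[R]_N :=
  invmx (diag_mx pi) *m (passage_matrix P X J v)^T *m diag_mx pi.

End Processes.

(* Main.v *)
Require Import Defs.
From HB Require Import structures.
From mathcomp Require Import all_boot all_order all_algebra.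
From mathcomp Require Import all_classical all_reals all_analysis.
From mathcomp Require Import measurable_realfun.
From mathcomp Require Import zify ring.

Set Implicit Arguments.
Unset Strict Implicit.
Unset Printing Implicit Defensive.

Import Order.TTheory GRing.Theory Num.Theory.
Import numFieldNormedType.Exports.

Local Open Scope classical_set_scope.
Local Open Scope ring_scope.

(** Shift the levels so that ruin means leaving the nonnegative integers:
    put a = u - 1 and b = x - 1, and let [walk Lam n a b] be the total weight
    of the n-step paths from a to b that stay nonnegative.  The potential is
    K(a, b) = \sum_n v^n walk n a b ([potentialE], [killed_law_walk]).

    For fixed b, conditioning on the first step gives a linear recursion for
    K(., b) in which K(a+1, b) has the invertible coefficient v Lam(0), so
    K(., b) is determined by K(0, b).  Matching coefficients in
    (v F(z) - I) \sum_n z^n W(n) = I ([scale_coef], [scale_recursion]) shows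
    that a |-> W(a+1) solves the homogeneous recursion and that
    a |-> - W(a-b) solves it with the source term at a = b.  Hence
    K(a, b) = W(a+1) C - W(a-b), with C = v Lam(0) K(0, b).

    It remains to see that C = R^(b+1).  Cutting a path from 0 to b+1 at its
    last visit to 0 ([walk_last_exit]) gives
    K(0, b+1) = K(0, 0) v Lam(0) K(0, b), so C is the (b+1)-st power of
    v Lam(0) K(0, 0).  Finally v Lam(0) K(0, 0) = R ([R_matrix_cvg]): read
    backwards, a path of the reversed chain that first exceeds level 0 at time
    n+1 is an upward step from -1 to 0 followed by a nonnegative path of
    length n from 0 to 0.  The same identity yields all the
    convergence: the passage probabilities of the reversed chain sum to at
    most 1, so K(0, 0) is finite as Lam(0) is invertible, then K(0, b) is
    finite by a Cauchy product, and the recursion propagates this to every a.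

    For the left equation, conditioning K(0, 0) on the last step and
    exchanging the sums gives
    K(0, 0) = I + v \sum_c K(0, 0) R^c Lam(c+1) ([left_series_cvg]).  As
    K(0, 0) dominates I entrywise, S = \sum_c R^c Lam(c+1) converges, and then
    K(0, 0) (I - v S) = I.  So K(0, 0) and R = v Lam(0) K(0, 0) are
    invertible, and R^-1 Lam(0) + S = v^-1 I. *)

(** * Real series and power series *)

Section ScalarSeries.
Context {R : realType}.
Implicit Types (a b c u : nat -> R).

Lemma nonneg_series_cvgE u (s : R) : (forall n, 0 <= u n) ->
  series u @ \oo --> s <-> (\sum_(0 <= n <oo) (u n)%:E = s%:E)%E.
Proof.
move=> u0.
have eqf : (EFin \o series u) = (fun n => \sum_(0 <= k < n) (u k)%:E)%E.
  by apply/funext => n /=; rewrite /series /= sumEFin.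
split=> [us|us].
  rewrite -eqf EFin_lim; last by apply/cvg_ex; exists s.
  by congr (_%:E); apply: cvg_lim us.
have cu : cvgn (series u) by apply: nnseries_is_cvg => //; rewrite us ltry.
have := us; rewrite -eqf EFin_lim // => -[<-].
exact: cu.
Qed.

Lemma series_triangle a b n :
  series (fun m => \sum_(k < m.+1) a k * b (m - k)%N) n =
  \sum_(i < n) a i * series b (n - i)%N.
Proof.
elim: n => [|n IH]; first by rewrite /series /= big_geq // big_ord0.
rewrite seriesSr IH [RHS]big_ord_recr /= subSnn.
rewrite [\sum_(k < n.+1) _]big_ord_recr /= addrA -big_split /= subnn.
congr (_ + _).
  apply: eq_bigr => i _; rewrite subSn; last exact/ltnW.
  by rewrite seriesSr mulrDr.
by rewrite /series /= big_nat1.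
Qed.

(** Mertens: by [series_triangle] the n-th partial sum differs from
    A_n * B by \sum_(i < n) a_i (B_(n-i) - B), which tends to 0: the
    second factor is small when i is far from n, and the other terms carry
    only a tail of \sum |a_i|. *)
Lemma cauchy_product_cvg a b (A B : R) :
  cvgn (series (fun n => `|a n|)) ->
  series a @ \oo --> A -> series b @ \oo --> B ->
  series (fun m => \sum_(k < m.+1) a k * b (m - k)%N) @ \oo --> A * B.
Proof.
move=> ca aA bB.
pose e n := series b n - B.
have e0 : e @ \oo --> (0 : R).
  by rewrite -(subrr B); apply: cvgB => //; exact: cvg_cst.
have [M M0 eM] : exists2 M : R, 0 < M & forall n, `|e n| <= M.
  have [M0 [_ Mb]] := cvg_seq_bounded (cvgP _ e0).
  exists (`|M0| + 1); first by rewrite ltr_wpDl.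
  by move=> n; apply: Mb => //; rewrite (le_lt_trans (ler_norm _)) // ltrDl.
pose S := limn (series (fun n => `|a n|)).
have leS n : series (fun n => `|a n|) n <= S.
  apply: nondecreasing_cvgn_le => //.
  by apply: nondecreasing_series => k _ _; exact: normr_ge0.
have S0 : 0 <= S by apply: le_trans (leS 0%N); rewrite /series /= big_geq.
suff d0 : (fun n => \sum_(i < n) a i * e (n - i)%N) @ \oo --> (0 : R).
  have -> : series (fun m => \sum_(k < m.+1) a k * b (m - k)%N) =
     (fun n => \sum_(i < n) a i * e (n - i)%N + series a n * B).
    apply/funext => n; rewrite series_triangle /series /= big_mkord mulr_suml.
    by rewrite -big_split /=; apply: eq_bigr => i _; rewrite /e mulrBr subrK.
  by rewrite -[A * B]add0r; apply: cvgD => //; apply: cvgM => //; exact: cvg_cst.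
apply/cvgrPdist_le => eps eps0.
(* the two halves of the split contribute at most S * d and (M + 1) * d *)
pose d := eps / (S + M + 1).
have SM0 : 0 < S + M + 1 by rewrite ltr_pwDr // addr_ge0 // ltW.
have d0 : 0 < d by rewrite divr_gt0.
have /cvgrPdist_le /(_ d d0) [m1 _ Hm1] := e0.
have /cvgrPdist_le /(_ d d0) [m2 _ Hm2] := ca.
exists (m1 + m2)%N => // n /= mn.
rewrite sub0r normrN.
have {}mn : (m1 + m2 <= n)%N by [].
rewrite -(big_mkord xpredT (fun i => a i * e (n - i)%N)).
rewrite (@big_cat_nat _ _ _ (n - m1)%N) //=; last exact: leq_subr.
apply: le_trans (ler_normD _ _) _.
have -> : eps = S * d + (M + 1) * d.
  by rewrite -mulrDl /d addrA mulrCA divff ?mulr1 // gt_eqF.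
apply: lerD.
  apply: le_trans (ler_norm_sum _ _ _) _.
  apply: le_trans (_ : \sum_(0 <= i < n - m1) `|a i| * d <= _).
    rewrite big_nat_cond [leRHS]big_nat_cond; apply: ler_sum => i.
    rewrite andbT => /andP[_ hi].
    rewrite normrM ler_wpM2l //.
    have /Hm1 /= : (m1 <= n - i)%N by lia.
    by rewrite sub0r normrN.
  rewrite -mulr_suml; apply: ler_wpM2r; [exact: ltW | exact: leS].
apply: le_trans (ler_norm_sum _ _ _) _.
apply: le_trans (_ : \sum_(n - m1 <= i < n) `|a i| * M <= _).
  by apply: ler_sum => i _; rewrite normrM ler_wpM2l.
rewrite -mulr_suml mulrC.
rewrite -(@sub_series_geq _ (fun i => `|a i|)) ?leq_subr //.
apply: ler_pM.
- exact: ltW.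
- rewrite subr_ge0.
  have nd : nondecreasing_seq (series (fun i => `|a i|)).
    by apply: nondecreasing_series => k _ _; exact: normr_ge0.
  by apply: nd; exact: leq_subr.
- by rewrite lerDl.
- have := Hm2 (n - m1)%N; rewrite /= => /(_ ltac:(lia)).
  rewrite ger0_norm ?subr_ge0 ?leS // => h.
  apply: le_trans h; rewrite lerB //; exact: leS.
Qed.

(** Away from its constant term the sum is at most |z| / r times
    \sum_n |c_n| r^n, so the constant term is O(|z|). *)
Lemma pseries0_coef0 c :
  (\forall z \near (0 : R)^', series (fun n => c n * z ^+ n) @ \oo --> (0 : R)) ->
  c 0%N = 0.
Proof.
move=> /nbhs_ballP [r0 /= r00 Hr0].
have H (z : R) : 0 < `|z| < r0 -> series (fun n => c n * z ^+ n) @ \oo --> (0 : R).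
  move=> /andP[z0 zr]; apply: Hr0; first by rewrite /ball /= sub0r normrN.
  by rewrite -normr_gt0.
(* absolute convergence at r follows from convergence at r0 / 2 > r *)
pose r := r0 / 3%:R.
have rp : 0 < r by rewrite divr_gt0.
have cr : cvgn (series (fun n => `|c n| * r ^+ n)).
  have : cvgn (pseries c (r0 / 2%:R)).
    apply/cvg_ex; exists 0; apply: H; rewrite ger0_norm; last by rewrite divr_ge0 // ltW.
    by rewrite divr_gt0 //= ltr_pdivrMr // ltr_pMr // ltr1n.
  move/is_cvg_pseries_inside_norm; apply.
  rewrite !ger0_norm ?divr_ge0 ?(ltW r00) //.
  rewrite ltr_pM2l // ltf_pV2 ?posrE ?ltr0n // ltr_nat //.
pose K := limn (series (fun n => `|c n| * r ^+ n)).
have term0 n : 0 <= `|c n| * r ^+ n by rewrite mulr_ge0 // exprn_ge0 // ltW.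
have leK n : series (fun n => `|c n| * r ^+ n) n <= K.
  apply: nondecreasing_cvgn_le => //.
  by apply: nondecreasing_series => k _ _; exact: term0.
have K0 : 0 <= K by apply: le_trans (leK 0%N); rewrite /series /= big_geq.
have bnd (z : R) : 0 < `|z| <= r -> `|c 0%N| <= `|z| / r * K.
  move=> /andP[z0 zr].
  have hz : series (fun n => c n * z ^+ n) @ \oo --> (0 : R).
    apply: H; rewrite z0 /= (le_lt_trans zr) //.
    by rewrite ltr_pdivrMr // ltr_pMr // ltr1n.
  have : (fun n => c 0%N - series (fun n => c n * z ^+ n) n) @ \oo --> c 0%N.
    rewrite -[X in _ --> X]subr0; apply: cvgB => //; exact: cvg_cst.
  move=> /cvg_norm hc.
  rewrite -(cvg_lim (@Rhausdorff R) hc); apply: limr_le; first exact: cvgP hc.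
  exists 1%N => // n /= n1.
  rewrite -(prednK n1) -[in series _ _](prednK n1) /series /= big_nat_recl //.
  rewrite expr0 mulr1 opprD addrA subrr sub0r normrN.
  apply: le_trans (ler_norm_sum _ _ _) _.
  apply: le_trans (_ : \sum_(0 <= i < n.-1) `|z| / r * (`|c i.+1| * r ^+ i.+1) <= _).
    apply: ler_sum => i _; rewrite normrM mulrCA ler_wpM2l //.
    rewrite normrX !exprS mulrA divfK ?gt_eqF // ler_wpM2l //.
    by rewrite lerXn2r // ?nnegrE // ltW.
  rewrite -mulr_sumr ler_wpM2l ?(divr_ge0 _ (ltW rp)) //.
  apply: le_trans (leK n); rewrite -[n in leRHS](prednK n1) /series /=.
  by rewrite [leRHS]big_nat_recl // ler_wpDl // term0.
apply/eqP; rewrite -normr_le0; apply/ler_addgt0Pr => eps eps0.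
rewrite add0r.
pose z := Num.min r (eps * r / (K + 1)).
have z0 : 0 < z by rewrite /z lt_min rp divr_gt0 ?mulr_gt0 // ltr_wpDl.
have := bnd z; rewrite ger0_norm ?(ltW z0) // z0 /= /z ge_min lexx => /(_ isT) h.
apply: le_trans h _.
rewrite -/z mulrAC ler_pdivrMr //.
apply: le_trans (_ : eps * r / (K + 1) * K <= _).
  by rewrite ler_wpM2r // ge_min lexx orbT.
rewrite mulrAC ler_pdivrMr ?ltr_wpDl //; apply: ler_wpM2l; last by rewrite lerDl.
by rewrite ltW // mulr_gt0.
Qed.

(** Identity theorem: once the constant term vanishes, dividing by z shifts the
    coefficients; only punctured neighbourhoods of 0 are involved. *)
Lemma pseries0_coef c :
  (\forall z \near (0 : R)^', series (fun n => c n * z ^+ n) @ \oo --> (0 : R)) ->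
  forall n, c n = 0.
Proof.
move=> hc n; elim: n c hc => [|n IH] c hc; first exact: pseries0_coef0.
have c0 := pseries0_coef0 hc.
apply: (IH (fun n => c n.+1)).
near=> z.
have z0 : z != 0 by near: z; exact: nbhs_dnbhs_neq.
have hz : series (fun n => c n * z ^+ n) @ \oo --> (0 : R) by near: z.
have := hz; rewrite -(cvg_shiftS _) /= => hz'.
have -> : series (fun n => c n.+1 * z ^+ n) =
    (fun n => z^-1 * series (fun n => c n * z ^+ n) n.+1).
  apply/funext => m; rewrite /series /= big_nat_recl // c0 mul0r add0r.
  rewrite mulr_sumr; apply: eq_bigr => i _.
  by rewrite exprS mulrCA mulKf.
rewrite -(mulr0 z^-1); apply: cvgM => //; exact: cvg_cst.
Unshelve. all: by end_near.
Qed.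

End ScalarSeries.

(** * Series of matrices *)

Section MatrixSeriesTheory.
Context {R : realType} {N : nat}.
Implicit Types (f g : nat -> 'M[R]_N) (F G C : 'M[R]_N).

Lemma series_sum_cvg (I : finType) (u : I -> nat -> R) (s : I -> R) :
  (forall l, series (u l) @ \oo --> s l) ->
  series (fun n => \sum_l u l n) @ \oo --> \sum_l s l.
Proof.
move=> us.
have -> : series (fun n => \sum_l u l n) = (fun n => \sum_l series (u l) n).
  by apply/funext => n; rewrite /series /= exchange_big.
by apply: cvg_big => [|l _]; [exact: add_continuous|exact: us].
Qed.

Lemma mx_series_cvg_unique f F G :
  mx_series_cvg f F -> mx_series_cvg f G -> F = G.
Proof.
move=> fF fG; apply/matrixP => i j.
exact: (cvg_unique (@Rhausdorff R) (fF i j) (fG i j)).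
Qed.

Lemma mx_series_cvgD f g F G : mx_series_cvg f F -> mx_series_cvg g G ->
  mx_series_cvg (fun n => f n + g n) (F + G).
Proof.
move=> fF gG i j.
have -> : (fun k => (f k + g k) i j) = (fun k => f k i j) + (fun k => g k i j).
  by apply/funext => k; rewrite mxE.
by rewrite seriesD mxE; apply: cvgD; [exact: fF|exact: gG].
Qed.

Lemma mx_series_cvg_mulmxl C f F :
  mx_series_cvg f F -> mx_series_cvg (fun n => C *m f n) (C *m F).
Proof.
move=> fF i j.
have -> : (fun k => (C *m f k) i j) = (fun k => \sum_l C i l * f k l j).
  by apply/funext => k; rewrite mxE.
rewrite mxE; apply: series_sum_cvg => l.
have -> : (fun k => C i l * f k l j) = C i l *: (fun k => f k l j) by [].
by rewrite seriesZ; apply: cvgZ; [exact: cvg_cst|exact: fF].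
Qed.

Lemma mx_series_cvg_mulmxr C f F :
  mx_series_cvg f F -> mx_series_cvg (fun n => f n *m C) (F *m C).
Proof.
move=> fF i j.
have -> : (fun k => (f k *m C) i j) = (fun k => \sum_l f k i l * C l j).
  by apply/funext => k; rewrite mxE.
rewrite mxE; apply: series_sum_cvg => l.
have -> : (fun k => f k i l * C l j) = C l j *: (fun k => f k i l).
  by apply/funext => k; rewrite mulrC.
rewrite seriesZ mulrC; apply: cvgZ; [exact: cvg_cst|exact: fF].
Qed.

Lemma mx_series_cvgZ (c : R) f F :
  mx_series_cvg f F -> mx_series_cvg (fun n => c *: f n) (c *: F).
Proof.
move=> /(mx_series_cvg_mulmxl (C := c%:M)); rewrite mul_scalar_mx.
by under [X in mx_series_cvg X]funext do rewrite mul_scalar_mx.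
Qed.

Lemma mx_series_cvgN f F :
  mx_series_cvg f F -> mx_series_cvg (fun n => - f n) (- F).
Proof.
move=> /(mx_series_cvgZ (c := -1)); rewrite scaleN1r.
by under [X in mx_series_cvg X]funext do rewrite scaleN1r.
Qed.

Lemma mx_series_cvgB f g F G : mx_series_cvg f F -> mx_series_cvg g G ->
  mx_series_cvg (fun n => f n - g n) (F - G).
Proof. by move=> fF /mx_series_cvgN; exact: mx_series_cvgD. Qed.

Lemma mx_series_cvg0 : mx_series_cvg (fun=> 0 : 'M[R]_N) 0.
Proof.
move=> i j; rewrite mxE.
rewrite (_ : series _ = cst 0); last first.
  by apply/funext => n; rewrite /series /= big1 // => k _; rewrite mxE.
exact: cvg_cst.
Qed.

Lemma mx_series_cvg_sum m (f : 'I_m -> nat -> 'M[R]_N) (F : 'I_m -> 'M[R]_N) :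
  (forall c, mx_series_cvg (f c) (F c)) ->
  mx_series_cvg (fun n => \sum_c f c n) (\sum_c F c).
Proof.
elim: m f F => [|m IH] f F fF.
  rewrite big_ord0; under [X in mx_series_cvg X]funext do rewrite big_ord0.
  exact: mx_series_cvg0.
rewrite big_ord_recl; under [X in mx_series_cvg X]funext do rewrite big_ord_recl.
apply: mx_series_cvgD; first exact: fF.
exact: (IH (fun c => f (lift ord0 c)) (fun c => F (lift ord0 c))).
Qed.

Lemma mx_series_cvg_shift f F :
  mx_series_cvg (fun n => f n.+1) F <-> mx_series_cvg f (f 0%N + F).
Proof.
have eqs i j : (fun n => series (fun k => f k i j) n.+1) =
    (fun n => f 0%N i j + series (fun k => f k.+1 i j) n).
  by apply/funext => n; rewrite /series /= big_nat_recl.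
split=> fF i j.
  by rewrite -(cvg_shiftS _) /= eqs mxE; apply: cvgD; [exact: cvg_cst|exact: fF].
have := fF i j; rewrite -(cvg_shiftS _) /= eqs mxE => h.
have -> : series (fun k => f k.+1 i j) =
    (fun n => (f 0%N i j + series (fun k => f k.+1 i j) n) - f 0%N i j).
  by apply/funext => n; rewrite addrC addKr.
rewrite (_ : F i j = f 0%N i j + F i j - f 0%N i j); last by rewrite addrC addKr.
by apply: cvgB => //; exact: cvg_cst.
Qed.

Lemma mx_cauchy_product_cvg f g F G :
  (forall i j, cvgn (series (fun n => `|f n i j|))) ->
  mx_series_cvg f F -> mx_series_cvg g G ->
  mx_series_cvg (fun m => \sum_(k < m.+1) f k *m g (m - k)%N) (F *m G).
Proof.
move=> fn fF gG i j.
have -> : (fun m => (\sum_(k < m.+1) f k *m g (m - k)%N) i j) =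
   (fun m => \sum_l \sum_(k < m.+1) f k i l * g (m - k)%N l j).
  apply/funext => m; rewrite summxE exchange_big /=.
  by apply: eq_bigr => k _; rewrite mxE.
rewrite mxE; apply: series_sum_cvg => l.
exact: cauchy_product_cvg (fn i l) (fF i l) (gG l j).
Qed.

Lemma mx_series_nonneg_norm_cvg f F : (forall n i j, 0 <= f n i j) ->
  mx_series_cvg f F -> forall i j, cvgn (series (fun n => `|f n i j|)).
Proof.
move=> f0 fF i j; under [X in cvgn (series X)]funext do rewrite ger0_norm //.
exact: cvgP (fF i j).
Qed.

Lemma mx_series_cvg_ge f F n i j : (forall n i j, 0 <= f n i j) ->
  mx_series_cvg f F -> f n i j <= F i j.
Proof.
move=> f0 fF; have Fij := fF i j; rewrite -(cvg_lim (@Rhausdorff R) Fij).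
apply: le_trans (_ : series (fun k => f k i j) n.+1 <= _).
  rewrite seriesS lerDl; apply: sumr_ge0 => k _; exact: f0.
apply: nondecreasing_cvgn_le; last exact: cvgP Fij.
by apply: nondecreasing_series => k _ _; exact: f0.
Qed.

Lemma mx_series_cvg_dominated f g G : (forall n i j, 0 <= f n i j <= g n i j) ->
  mx_series_cvg g G -> mx_series_cvg f (mx_series f).
Proof.
move=> fg gG i j; rewrite mxE.
have : cvgn (series (fun k => f k i j)); last by [].
apply: series_le_cvg (cvgP _ (gG i j)) => n.
- by case/andP: (fg n i j).
- by have /andP[/le_trans h /h] := fg n i j.
- by case/andP: (fg n i j).
Qed.

Lemma mx_seriesE f F : mx_series_cvg f F -> mx_series f = F.
Proof.
by move=> fF; apply/matrixP => i j; rewrite mxE; apply: cvg_lim => //; exact: fF.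
Qed.

(** Tonelli for a double series of nonnegative matrices: if the rows have
    sums [Fr] and the columns have sums [Fc], summing the former to [F] forces
    the latter to sum to [F]. *)
Lemma mx_series_cvg_swap (f : nat -> nat -> 'M[R]_N) (Fr Fc : nat -> 'M[R]_N) F :
  (forall m n i j, 0 <= f m n i j) ->
  (forall m, mx_series_cvg (f m) (Fr m)) ->
  (forall n, mx_series_cvg (f^~ n) (Fc n)) ->
  mx_series_cvg Fr F -> mx_series_cvg Fc F.
Proof.
move=> f0 fr fc frF i j.
have Fr0 m : 0 <= Fr m i j.
  exact: le_trans (f0 m 0%N i j) (mx_series_cvg_ge _ _ _ (f0 m) (fr m)).
have Fc0 n : 0 <= Fc n i j.
  exact: le_trans (f0 0%N n i j) (mx_series_cvg_ge _ _ _ (fun m => f0 m n) (fc n)).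
apply/nonneg_series_cvgE => //.
have /nonneg_series_cvgE <- // := frF i j.
transitivity (\sum_(0 <= n <oo) \sum_(0 <= m <oo) (f m n i j)%:E)%E.
  apply: eq_eseriesr => n _; apply/esym/nonneg_series_cvgE => [m|]; first exact: f0.
  exact: fc.
rewrite nneseries_interchange; last by move=> m n; rewrite lee_fin f0.
apply: eq_eseriesr => m _; apply/nonneg_series_cvgE => [n|]; first exact: f0.
exact: fr.
Qed.

Lemma mulmx_ge0 (A B : 'M[R]_N) : (forall i j, 0 <= A i j) ->
  (forall i j, 0 <= B i j) -> forall i j, 0 <= (A *m B) i j.
Proof. by move=> A0 B0 i j; rewrite mxE sumr_ge0 // => k _; rewrite mulr_ge0. Qed.

Lemma expmx_ge0 (A : 'M[R]_N) n : (forall i j, 0 <= A i j) ->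
  forall i j, 0 <= (A ^+ n) i j.
Proof.
move=> A0; elim: n => [|n IH] i j; first by rewrite expr0 mxE ler0n.
by rewrite exprS; apply: mulmx_ge0.
Qed.

End MatrixSeriesTheory.

(** * Events decided by the past of a modulated sequence *)

Section ModulatedPast.
Context {R : realType} {N : nat} {d : measure_display} {T : measurableType d}.
Context {V : countType} {K : V -> 'M[R]_N} {P : 'I_N -> probability T R}.
Context {xi : nat -> T -> V} {J : nat -> T -> 'I_N}.
Hypothesis hM : modulated_sequence K P xi J.

Definition same_past (n : nat) (w w' : T) : Prop :=
  (forall k, (k <= n)%N -> J k w = J k w') /\
  (forall k, (0 < k <= n)%N -> xi k w = xi k w').

Definition past_determined (n : nat) (C : set T) : Prop :=
  forall w w', same_past n w w' -> C w -> C w'.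

(** The past up to time n takes countably many values; numbering them turns
    every event decided by the past into a countable union of histories. *)
Definition past_code (n : nat) (w : T) : nat :=
  pickle ([seq J k w | k <- iota 0 n.+1], [seq xi k w | k <- iota 1 n]).

Lemma past_codeP n w w' : same_past n w w' <-> past_code n w = past_code n w'.
Proof.
split=> [[hJ hx]|/(pcan_inj pickleK) [e0 hJ hx]].
  rewrite /past_code; congr (pickle (_, _)); apply/eq_in_map => k.
    by rewrite mem_iota => /andP[_ kn]; exact: hJ.
  by rewrite mem_iota add1n ltnS; exact: hx.
split=> k kn.
  case: k kn => [//|k] kn.
  by move/eq_in_map: hJ; apply; rewrite mem_iota; lia.
by move/eq_in_map: hx; apply; rewrite mem_iota; lia.
Qed.

Lemma history_measurable (x : nat -> V) (s : nat -> 'I_N) n :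
  measurable (history xi J x s n).
Proof.
have [mx mJ _ _] := hM.
rewrite (_ : history _ _ _ _ _ =
    (\bigcap_k (if (k <= n)%N then J k @^-1` [set s k] else setT)) `&`
    (\bigcap_k (if (k < n)%N then xi k.+1 @^-1` [set x k.+1] else setT))).
  by apply: measurableI; apply: bigcapT_measurable => k; case: ifP.
apply/seteqP; split=> [w [hJ hx]|w [hJ hx]]; split.
- by move=> k _; case: ifP => // kn; exact: hJ.
- by move=> k _; case: ifP => // kn; exact: hx.
- by move=> k kn; have := hJ k I; rewrite kn.
- by case=> [//|k] /= kn; have := hx k I; rewrite kn.
Qed.

(** This is what lets the hypothesis on single histories speak about all events
    decided by the past. *)
Lemma past_cell n (C : set T) m : past_determined n C ->
  C `&` past_code n @^-1` [set m] = set0 \/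
  exists2 w0, C w0 & C `&` past_code n @^-1` [set m] =
                     history xi J (xi^~ w0) (J^~ w0) n.
Proof.
move=> dC; have [->|/set0P [w0 [Cw0 cw0]]] :=
  eqVneq (C `&` past_code n @^-1` [set m]) set0.
  by left.
right; exists w0 => //; apply/seteqP; split=> w.
  move=> [Cw cw]; have [hJ hx] : same_past n w w0 by apply/past_codeP; rewrite cw cw0.
  by split.
move=> [hJ hx]; have sp : same_past n w w0 by split.
split; last by rewrite /= -cw0; apply/past_codeP.
apply: dC Cw0; case: sp => hJ' hx'; split=> k kn; first by rewrite hJ'.
by rewrite hx'.
Qed.

Lemma past_code_cover n (C : set T) :
  C = \bigcup_m (C `&` past_code n @^-1` [set m]).
Proof.
apply/seteqP; split=> [w Cw|w [m _ []//]].
by exists (past_code n w).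
Qed.

Lemma past_determined_measurable n C : past_determined n C -> measurable C.
Proof.
move=> dC; rewrite (past_code_cover n C).
apply: bigcupT_measurable => m.
by have [->|[w0 _ ->]] := past_cell m dC; [exact: measurable0|exact: history_measurable].
Qed.

Lemma measure_past_split n (i : 'I_N) (E : set T) : measurable E ->
  P i E = (\sum_(0 <= m <oo) P i (E `&` past_code n @^-1` [set m]))%E.
Proof.
move=> mE.
have mF m : measurable (E `&` past_code n @^-1` [set m]).
  apply: measurableI => //; apply: (@past_determined_measurable n) => w w'.
  by move=> /past_codeP /= ->.
have EE := past_code_cover n E.
rewrite {1}EE; apply: measure_semi_bigcup => //; last by rewrite -EE.
by apply/trivIsetP => m1 m2 _ _ /eqP m12; apply/seteqP; split => // w [[_ /= ->] [_ /= ]].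
Qed.

(** The one-step law, known for histories, extends to any event decided by the
    past by summing over the histories that compose it. *)
Lemma modulated_step n (i : 'I_N) C a k j : past_determined n C ->
  (P i (C `&` J n @^-1` [set k] `&` xi n.+1 @^-1` [set a] `&`
         J n.+1 @^-1` [set j]) =
   P i (C `&` J n @^-1` [set k]) * (K a k j)%:E)%E.
Proof.
move=> dC0; set C' := C `&` J n @^-1` [set k].
have dC : past_determined n C'.
  move=> w w' ww' [Cw Jw]; split; first exact: dC0 Cw.
  by rewrite /= -(ww'.1 n (leqnn n)).
have [mx mJ _ hstep] := hM.
have mC' := past_determined_measurable dC.
have mE : measurable (C' `&` xi n.+1 @^-1` [set a] `&` J n.+1 @^-1` [set j]).
  by apply: measurableI; [apply: measurableI|].
rewrite (measure_past_split n i mE) (measure_past_split n i mC') muleC.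
rewrite -nneseriesZl //; apply: eq_eseriesr => m _.
rewrite muleC.
have -> : C' `&` xi n.+1 @^-1` [set a] `&` J n.+1 @^-1` [set j] `&`
    past_code n @^-1` [set m] =
    (C' `&` past_code n @^-1` [set m]) `&` (xi n.+1 @^-1` [set a] `&` J n.+1 @^-1` [set j]).
  by rewrite setIAC -[X in X `&` _]setIAC -setIA.
have [->|[w0 [_ Jw0] ->]] := past_cell m dC.
  by rewrite set0I measure0 mul0e.
(* extend the history through w0 by the prescribed values at time n + 1 *)
pose x l := if l == n.+1 then a else xi l w0.
pose s l := if l == n.+1 then j else J l w0.
have := hstep i n x s.
have -> : history xi J x s n = history xi J (xi^~ w0) (J^~ w0) n.
  rewrite /history; apply/seteqP; split => w [hJ hx]; split=> l ln.
  - by rewrite hJ // /s ifN //; apply/eqP; lia.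
  - by rewrite hx // /x ifN //; apply/eqP; lia.
  - by rewrite hJ // /s ifN //; apply/eqP; lia.
  - by rewrite hx // /x ifN //; apply/eqP; lia.
have -> : s n = k by rewrite /s ifN //; apply/eqP; lia.
rewrite /x /s eqxx => <-; congr (P i _).
apply/seteqP; split=> w.
  move=> [[hJ hx] [/= xa Jj]]; split=> l ln; case: eqP => [->//|/eqP ln'].
  - by apply: hJ; lia.
  - by apply: hx; lia.
move=> [hJ hx]; split; last first.
  by split=> /=; [have := hx n.+1|have := hJ n.+1]; rewrite eqxx leqnn; apply.
split=> l ln.
- by have := hJ l ltac:(lia); rewrite ifN //; apply/eqP; lia.
- by have := hx l ltac:(lia); rewrite ifN //; apply/eqP; lia.
Qed.

Definition allowed_past (bad : pred V) (n : nat) : set T :=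
  [set w | forall k, (0 < k <= n)%N -> ~~ bad (xi k w)].

(** Values to which the kernel gives no mass may be excluded from the path:
    each history containing one has probability zero, and there are countably
    many histories. *)
Lemma measure_allowed_past (bad : pred V) n (i : 'I_N) (C : set T) :
  (forall a, bad a -> K a = 0) -> measurable C ->
  P i C = P i (C `&` allowed_past bad n).
Proof.
move=> badK mC.
have [mx mJ _ hstep] := hM.
have dG : past_determined n (~` allowed_past bad n).
  move=> w w' [_ hx] nG G; apply: nG => k kn; rewrite hx //; exact: G.
have mG : measurable (allowed_past bad n).
  by rewrite -[allowed_past _ _]setCK; apply: measurableC; exact: past_determined_measurable dG.
have null k x s m : (0 < k <= m)%N -> bad (x k) -> P i (history xi J x s m) = 0%E.
  elim: m => [|m IH] km bx; first by lia.
  rewrite hstep; have [km'|km'] := leqP k m.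
    by rewrite IH ?mul0e //; lia.
  have -> : m.+1 = k by lia.
  by rewrite badK // mxE mule0.
have G0 : P i (~` allowed_past bad n) = 0%E.
  rewrite (measure_past_split n i (measurableC mG)).
  rewrite eseries0 // => m _ _.
  have [->|[w0 nG ->]] := past_cell m dG; first by rewrite measure0.
  have [k /not_implyP [kn /negP /negPn bk]] :
      exists k, ~ ((0 < k <= n)%N -> ~~ bad (xi k w0)).
    exact/existsNP.
  exact: null kn bk.
rewrite (measureDI (P i) mC mG) -[RHS]add0e; congr (_ + _)%E.
apply: subset_measure0 G0; [exact: measurableD|exact: measurableC|].
exact: subIsetr.
Qed.

End ModulatedPast.

Lemma measure_finite_bigcup {R : realType} {d} {T : measurableType d}
    (P : probability T R) (I : finType) (F : I -> set T) :
  (forall i, measurable (F i)) -> trivIset setT F ->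
  P (\bigcup_i F i) = (\sum_i P (F i))%E.
Proof.
move=> mF tF.
have eT : [set` index_enum I] = [set: I].
  by apply/seteqP; split=> // i _ /=; rewrite mem_index_enum.
rewrite measure_fin_bigcup //; last exact: finite_finset.
by rewrite -eT -fsbig_seq // index_enum_uniq.
Qed.

(** * Markov additive chains killed outside a set of levels *)

Section KilledMAC.
Context {R : realType} {N : nat} {d : measure_display} {T : measurableType d}.
Context {A : int -> 'M[R]_N} {P : 'I_N -> probability T R}.
Context {X : nat -> T -> int} {J : nat -> T -> 'I_N}.
Hypothesis hX : markov_additive_chain A P X J.
Hypothesis skipfree : forall m : int, 1 < m -> A m = 0.
Variable D : pred int.

Definition confined (n : nat) : set T := [set w | forall k, (k <= n)%N -> D (X k w)].

(** Unlike [killed_event], the last level is not required to satisfy [D]: this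
    covers both a further confined step and the moment of leaving [D]. *)
Definition exit_event (n : nat) (y : int) (j : 'I_N) : set T :=
  confined n `&` X n.+1 @^-1` [set y] `&` J n.+1 @^-1` [set j].

Definition killed_event (n : nat) (y : int) (j : 'I_N) : set T :=
  confined n `&` X n @^-1` [set y] `&` J n @^-1` [set j].

Definition exit_law (n : nat) (y : int) : 'M[R]_N :=
  \matrix_(i, j) fine (P i (exit_event n y j)).

Definition killed_law (n : nat) (y : int) : 'M[R]_N :=
  \matrix_(i, j) fine (P i (killed_event n y j)).

Let past_determined_ := @past_determined N d T int (fun n w => X n w - X n.-1 w) J.

Lemma level_same_past n w w' :
  same_past (xi := fun n w => X n w - X n.-1 w) (J := J) n w w' ->
  forall k, (k <= n)%N -> X k w = X k w'.
Proof.
move=> [_ hx]; elim=> [|k IH] kn; first by rewrite !hX.1.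
by have /= := hx k.+1 kn; rewrite IH 1?ltnW // => /addIr.
Qed.

Lemma confined_past n y :
  past_determined_ n (confined n `&` X n @^-1` [set y]).
Proof.
move=> w w' ww' [cw Xw]; have e := level_same_past ww'; split.
  by move=> k kn; rewrite -e //; exact: cw.
by rewrite /= -e.
Qed.

Lemma killed_event_past n y j : past_determined_ n (killed_event n y j).
Proof.
move=> w w' ww' [/(confined_past ww') cw Jw]; split=> //.
by rewrite /= -(ww'.1 n).
Qed.

Lemma killed_event_measurable n y j : measurable (killed_event n y j).
Proof. exact: (past_determined_measurable hX.2 (@killed_event_past n y j)). Qed.

Lemma exit_event_measurable n y j : measurable (exit_event n y j).
Proof.
apply: (past_determined_measurable (n := n.+1) hX.2) => w w' ww' [[cw Xw] Jw].
have e := level_same_past ww'; split; first split.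
- by move=> k kn; rewrite -e //; [exact: cw|exact: leqW].
- by rewrite /= -e.
- by rewrite /= -(ww'.1 n.+1).
Qed.

Lemma killed_lawE n y i j : P i (killed_event n y j) = (killed_law n y i j)%:E.
Proof. by rewrite mxE fineK // fin_num_measure //; exact: killed_event_measurable. Qed.

Lemma exit_eventE n y i j : P i (exit_event n y j) = (exit_law n y i j)%:E.
Proof. by rewrite mxE fineK // fin_num_measure //; exact: exit_event_measurable. Qed.

Definition no_upward_jump (n : nat) : set T :=
  [set w | forall k, (0 < k <= n)%N -> X k w - X k.-1 w <= 1].

Lemma measure_no_upward_jump n i (C : set T) : measurable C ->
  P i C = P i (C `&` no_upward_jump n).
Proof.
move=> mC.
rewrite (measure_allowed_past (bad := fun m : int => 1 < m) hX.2 n i skipfree mC).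
congr (P i (_ `&` _)); apply/seteqP.
by split=> w h k kn; have := h k kn; rewrite -leNgt.
Qed.

(** Conditioning on the last step.  Upward skip-freeness confines the level
    before that step to a finite window [phi], and so keeps the sum finite: the
    window is only required to contain that level on paths without upward jumps,
    which carry all the mass. *)
Lemma exit_law_step (B : nat) (phi : 'I_B -> int) n y : injective phi ->
  (forall w, no_upward_jump n.+1 w -> confined n w -> X n.+1 w = y ->
     exists c, phi c = X n w) ->
  exit_law n y = \sum_c killed_law n (phi c) *m A (y - phi c).
Proof.
move=> phi_inj window; apply/matrixP => i j; rewrite summxE.
have [mx mJ _ _] := hX.2.
apply: EFin_inj; rewrite -exit_eventE.
pose F (ck : 'I_B * 'I_N) := killed_event n (phi ck.1) ck.2
  `&` (fun w => X n.+1 w - X n w) @^-1` [set y - phi ck.1] `&` J n.+1 @^-1` [set j].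
have mF ck : measurable (F ck).
  apply: measurableI => //; apply: measurableI; first exact: killed_event_measurable.
  exact: (mx n).
have mU : measurable (\bigcup_ck F ck).
  by apply: fin_bigcup_measurable => [|ck _]; [exact: finite_finset|exact: mF].
have -> : P i (exit_event n y j) = P i (\bigcup_ck F ck).
  rewrite (measure_no_upward_jump n.+1 i (exit_event_measurable n y j)).
  rewrite (measure_no_upward_jump n.+1 i mU); congr (P i _).
  apply/seteqP; split=> w.
    move=> [[[cw Xw] Jw] gw]; split=> //.
    have [c hc] := window w gw cw Xw.
    by exists (c, J n w) => //; split; [split; [split; [split|]|]|]; rewrite //= ?hc ?Xw.
  move=> [[ck _ [[[[cw Xw] Jw] /= dw] Jw']] gw]; split=> //; split=> //; split=> //=.
  by rewrite -[X _ w](subrK (X n w)) dw Xw subrK.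
rewrite measure_finite_bigcup //; last first.
  apply/trivIsetP => -[c k] [c' k'] _ _ /eqP ne; apply/seteqP; split=> // w.
  move=> [[[[[_ /= X1] /= J1] _] _] [[[[_ /= X2] /= J2] _] _]]; apply: ne.
  by rewrite -J1 -J2 (phi_inj c c') // -X1 -X2.
transitivity (\sum_ck (killed_law n (phi ck.1) i ck.2)%:E *
    (A (y - phi ck.1) ck.2 j)%:E)%E.
  apply: eq_bigr => -[c k] _; rewrite -killed_lawE.
  by apply: (modulated_step hX.2); exact: confined_past.
rewrite -(pair_bigA _ (fun c k =>
  ((killed_law n (phi c) i k)%:E * (A (y - phi c) k j)%:E)%E)) /=.
rewrite -sumEFin; apply: eq_bigr => c _; rewrite mxE -sumEFin.
by apply: eq_bigr => k _.
Qed.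

Lemma killed_law_exit n y : D y -> killed_law n.+1 y = exit_law n y.
Proof.
move=> Dy; apply/matrixP => i j; rewrite !mxE; congr (fine (P i _)).
apply/seteqP; split=> w [[cw Xw] Jw]; split=> //; split=> // k kn.
  by apply: cw; exact: leqW.
by move: kn; rewrite leq_eqVlt => /predU1P[->|/cw //]; rewrite Xw.
Qed.

Lemma killed_law0 y : D 0 -> killed_law 0 y = (y == 0)%:R%:M.
Proof.
move=> D0; have [_ mJ P1 _] := hX.2; apply/matrixP => i j; rewrite !mxE.
case: eqVneq => [->|y0]; last first.
  rewrite (_ : killed_event _ _ _ = set0) ?measure0 ?mul0rn //.
  by apply/seteqP; split=> // w [[_ /= Xw] _]; move: y0; rewrite -Xw hX.1 eqxx.
have -> : killed_event 0 0 j = J 0%N @^-1` [set j].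
  apply/seteqP; split=> [w []//|w Jw]; split=> //; split; last by rewrite /= hX.1.
  by case=> // _; rewrite hX.1.
case: eqVneq => [->|ij]; first by rewrite P1.
rewrite (@subset_measure0 _ _ _ (P i) _ (~` (J 0%N @^-1` [set i]))) //=.
- exact: measurableC.
- by move=> w /= ->; apply/eqP; rewrite eq_sym.
- by rewrite probability_setC // P1 subee.
Qed.

End KilledMAC.

(** * Weighted nonnegative paths *)

Section Walk.
Context {R : realType} {N : nat}.
Variable Lam : nat -> 'M[R]_N.
Local Notation inc := (increment Lam).

(** Path weights, conditioned on the first step.  From a one moves to at most
    a + 1, whence the range of the sum, and c ranges over the nonnegative
    levels, whence the killing. *)
Fixpoint walk (n a b : nat) : 'M[R]_N :=
  if n is n'.+1 then \sum_(c < a.+2) inc (c%:Z - a%:Z) *m walk n' c b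
  else (a == b)%:R%:M.

Lemma neq_scalar_mx (a b : nat) : a != b -> (a == b)%:R%:M = 0 :> 'M[R]_N.
Proof. by move/negbTE->; rewrite raddf0. Qed.

Lemma increment1 : inc 1 = Lam 0%N.
Proof. by rewrite /increment lexx. Qed.

Lemma increment_gt1 (m : int) : 1 < m -> inc m = 0.
Proof. by move=> m1; rewrite /increment leNgt m1. Qed.

Lemma increment_1B (m : nat) : inc (1 - m%:Z) = Lam m.
Proof.
rewrite /increment ifT; last by lia.
by congr (Lam _); lia.
Qed.

(** Conditioning on the last step instead; any B beyond the highest level
    a + n that is reachable in n steps will do. *)
Lemma walk_last n a b B : (a + n < B)%N ->
  walk n.+1 a b = \sum_(c < B) walk n a c *m inc (b%:Z - c%:Z).
Proof.
elim: n a b => [|n IH] a b nB.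
  transitivity (inc (b%:Z - a%:Z)).
    have [ba|ab] := ltnP b a.+2.
      rewrite /= (bigD1 (Ordinal ba)) //= eqxx mulmx1 big1 ?addr0 // => c cb.
      by rewrite neq_scalar_mx ?mulmx0.
    rewrite increment_gt1; last by lia.
    rewrite /= big1 // => c _; rewrite neq_scalar_mx ?mulmx0 //.
    by have := ltn_ord c; apply: contraTneq => ->; rewrite -leqNgt.
  rewrite addn0 in nB; rewrite (bigD1 (Ordinal nB)) //= eqxx mul1mx big1 ?addr0 //.
  move=> c cb; rewrite neq_scalar_mx ?mul0mx //.
  by apply: contraNneq cb => e; apply/eqP/val_inj.
rewrite [LHS]/=.
transitivity (\sum_(c < a.+2) \sum_(e < B)
    inc (c%:Z - a%:Z) *m (walk n c e *m inc (b%:Z - e%:Z))).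
  apply: eq_bigr => c _; rewrite -mulmx_sumr -IH //.
  by have := ltn_ord c; lia.
rewrite exchange_big /=; apply: eq_bigr => e _.
by rewrite mulmx_suml; apply: eq_bigr => c _; rewrite mulmxA.
Qed.

Lemma walk_far n a b : (a + n < b)%N -> walk n a b = 0.
Proof.
elim: n a => [|n IH] a ab /=; first by rewrite neq_scalar_mx //; apply/eqP; lia.
rewrite big1 // => c _; rewrite IH ?mulmx0 //.
by have := ltn_ord c; lia.
Qed.

Lemma walk_ge0 n a b : (forall m i j, 0 <= Lam m i j) ->
  forall i j, 0 <= walk n a b i j.
Proof.
move=> L0; elim: n a => [|n IH] a i j /=.
  by rewrite !mxE; case: (i == j); case: (a == b).
rewrite summxE sumr_ge0 // => c _; apply: mulmx_ge0 => // {}i {}j.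
by rewrite /increment; case: ifP => // _; rewrite mxE.
Qed.

(** Cut the path at its last visit to 0, at time k: being upward skip-free it
    then steps to 1, with weight Lam(0), and afterwards stays above 0, which
    is a nonnegative path from 0 to b after lowering the levels by 1. *)
Lemma walk_last_exit n b :
  walk n 0 b.+1 = \sum_(k < n) walk k 0 0 *m Lam 0%N *m walk (n.-1 - k) 0 b.
Proof.
elim: n b => [|n IH] b; first by rewrite big_ord0 /= raddf0.
rewrite (@walk_last _ _ _ n.+2) ?add0n // big_ord_recl [RHS]big_ord_recr /= addrC subnn.
congr (_ + _).
  rewrite -mulmxA; congr (_ *m _); case: b {IH} => [|b].
    by rewrite subr0 increment1 /= mulmx1.
  rewrite increment_gt1; last by lia.
  by rewrite /= raddf0 !mulmx0.
transitivity (\sum_(c < n.+1) \sum_(k < n)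
    walk k 0 0 *m Lam 0%N *m (walk (n.-1 - k) 0 c *m inc (b%:Z - c%:Z))).
  apply: eq_bigr => c _; rewrite /bump /= add1n IH mulmx_suml.
  rewrite (_ : b.+1%:Z - c.+1%:Z = b%:Z - c%:Z); last by lia.
  by apply: eq_bigr => k _; rewrite -mulmxA.
rewrite exchange_big /=; apply: eq_bigr => k _.
have kn := ltn_ord k.
rewrite -mulmx_sumr -walk_last ?add0n; last by lia.
by congr (_ *m walk _ _ _); lia.
Qed.

End Walk.

Section WalkLaw.
Context {R : realType} {N : nat} {d : measure_display} {T : measurableType d}.
Context {Lam : nat -> 'M[R]_N} {P : 'I_N -> probability T R}.
Context {X : nat -> T -> int} {J : nat -> T -> 'I_N}.

Lemma level_le_time w n : X 0%N w = 0 -> no_upward_jump (X := X) n w -> X n w <= n%:Z.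
Proof.
move=> X0; elim: n => [|n IH] h; first by rewrite X0.
have := h n.+1; rewrite /= leqnn => /(_ isT) h1.
have : X n w <= n%:Z by apply: IH => k kn; apply: h; lia.
by lia.
Qed.

(** A chain started at 0 and confined to the levels >= -a is a walk started
    at a and confined to the nonnegative levels; the proof compares the
    last-step recursions. *)
Lemma killed_law_walk (a n b : nat) :
  markov_additive_chain (increment Lam) P X J ->
  killed_law (P := P) (X := X) (J := J) (fun y => 0 <= a%:Z + y) n (b%:Z - a%:Z)
  = walk Lam n a b.
Proof.
move=> hX; elim: n b => [|n IH] b.
  rewrite (killed_law0 hX) /=; last by lia.
  by rewrite subr_eq0 eqz_nat eq_sym.
rewrite killed_law_exit; last by lia.
rewrite (@walk_last _ _ _ _ _ _ (a + n).+1) //.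
rewrite (exit_law_step hX (@increment_gt1 _ _ Lam)
  (phi := fun c : 'I_(a + n).+1 => c%:Z - a%:Z)).
- apply: eq_bigr => c _; rewrite IH; congr (_ *m increment _ _); lia.
- by move=> c c' /addIr [] /val_inj.
- move=> w gw cw _.
  have Xn : X n w <= n%:Z.
    apply: level_le_time; first exact: hX.1.
    by move=> k kn; apply: gw; lia.
  have Xa : 0 <= a%:Z + X n w := cw n (leqnn n).
  have h : (`|(a%:Z + X n w)%R| < (a + n).+1)%N by lia.
  by exists (Ordinal h) => /=; lia.
Qed.

(** Time reversal: transposing the last-step recursion of the reversed chain,
    confined to the levels <= 0, gives the first-step recursion of [walk]. *)
Lemma reversed_killed_law_walk (pi : 'rV[R]_N) (n l : nat) :
  diag_mx pi \in unitmx ->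
  markov_additive_chain (reversed_increment (increment Lam) pi) P X J ->
  killed_law (P := P) (X := X) (J := J) (fun y => y <= 0) n (- l%:Z) =
  invmx (diag_mx pi) *m (walk Lam n l 0)^T *m diag_mx pi.
Proof.
move=> uD hX.
have skip m : 1 < m -> reversed_increment (increment Lam) pi m = 0.
  by move=> m1; rewrite /reversed_increment increment_gt1 // trmx0 mulmx0 mul0mx.
elim: n l => [|n IH] l.
  rewrite (killed_law0 hX) // oppr_eq0 eqz_nat /=.
  rewrite tr_scalar_mx mul_mx_scalar -scalemxAl mulVmx //.
  by rewrite scalemx1.
rewrite killed_law_exit; last by lia.
rewrite (exit_law_step hX skip (phi := fun c : 'I_l.+2 => - c%:Z)).
- rewrite /= raddf_sum /= mulmx_sumr mulmx_suml; apply: eq_bigr => c _.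
  rewrite IH /reversed_increment trmx_mul !mulmxA.
  rewrite (_ : - l%:Z - - c%:Z = c%:Z - l%:Z); last by lia.
  by rewrite mulmxK.
- by move=> c c' /oppr_inj [] /val_inj.
- move=> w gw cw Xw; have := gw n.+1; rewrite leqnn => /(_ isT) /= hj.
  have Xn : X n w <= 0 := cw n (leqnn n).
  have h : (`|X n w| < l.+2)%N by lia.
  by exists (Ordinal h) => /=; lia.
Qed.

End WalkLaw.

(** * Passage and ruin times *)

Lemma first_time_someP (S : pred nat) n :
  first_time S = Some n <-> S n /\ (forall k, (k < n)%N -> ~~ S k).
Proof.
rewrite /first_time; case: pselect => [h|h]; last first.
  by split=> // -[Sn _]; case: h; exists n.
case: ex_minnP => m Sm mmin; split=> [[<-]|[Sn nmin]].
  by split=> // k; rewrite ltnNge; apply: contra; exact: mmin.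
congr Some; apply/eqP; rewrite eqn_leq mmin //= leqNgt.
by apply/negP => /nmin; rewrite Sm.
Qed.

Lemma before_first_time (S : pred nat) n :
  before n (first_time S) <-> forall k, (k <= n)%N -> ~~ S k.
Proof.
rewrite /first_time; case: pselect => [h|h] /=; last first.
  by split=> // _ k _; apply/negP => Sk; apply: h; exists k.
case: ex_minnP => m Sm mmin; split=> [nm k kn|h'].
  by apply: contraL nm => /mmin; rewrite -leqNgt => mk; exact: leq_trans kn.
by rewrite ltnNge; apply/negP => /h'; rewrite Sm.
Qed.

Lemma series_single_cvg {R : realType} (u : nat -> R) m :
  (forall n, n != m -> u n = 0) -> series u @ \oo --> u m.
Proof.
move=> u0; apply: cvg_near_cst; exists m.+1 => // n /= mn.
rewrite /series /= big_mkord (bigD1 (Ordinal mn)) //= big1 ?addr0 // => k km.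
by apply: u0; apply: contraNneq km => e; apply/eqP/val_inj.
Qed.

Section PassageMatrix.
Context {R : realType} {N : nat} {d : measure_display} {T : measurableType d}.
Context {A : int -> 'M[R]_N} {P : 'I_N -> probability T R}.
Context {X : nat -> T -> int} {J : nat -> T -> 'I_N}.
Hypothesis hX : markov_additive_chain A P X J.
Hypothesis skipfree : forall m : int, 1 < m -> A m = 0.

Definition passage_event (n : nat) (j : 'I_N) : set T :=
  [set w | passage_time X w = Some n /\ J n w = j].

Lemma passage_event_measurable n j : measurable (passage_event n j).
Proof.
apply: (past_determined_measurable (n := n) hX.2) => w w' ww'.
have e := level_same_past hX ww'.
move=> [/first_time_someP [Xn Xk] Jn]; split; last by rewrite -(ww'.1 n).
apply/first_time_someP; rewrite -e //; split=> // k kn; rewrite -e; first exact: Xk.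
exact: ltnW.
Qed.

Lemma passage_event0 j : passage_event 0 j = set0.
Proof.
by apply/seteqP; split=> // w [/first_time_someP [+ _] _]; rewrite hX.1.
Qed.

(** By skip-freeness the first passage above 0 happens by a step to
    exactly 1. *)
Lemma measure_passage_event i n j :
  P i (passage_event n.+1 j) =
  (exit_law (P := P) (X := X) (J := J) (fun y => y <= 0) n 1 i j)%:E.
Proof.
rewrite -(exit_eventE hX).
rewrite (measure_no_upward_jump hX skipfree n.+1 i (passage_event_measurable _ _)).
rewrite (measure_no_upward_jump hX skipfree n.+1 i (exit_event_measurable hX _ _ _ _)).
congr (P i _); apply/seteqP; split=> w.
  move=> [[/first_time_someP [X1 Xk] Jn] gw]; split=> //.
  have cw : confined (X := X) (fun y => y <= 0) n w.
    by move=> k kn; have := Xk k ltac:(lia); lia.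
  split; [split=> //|by []]; rewrite /=.
  have := gw n.+1; rewrite leqnn => /(_ isT) /=.
  by have := cw n (leqnn n); lia.
move=> [[[cw /= Xn] /= Jn] gw]; split=> //; split=> //.
apply/first_time_someP; split; first by rewrite Xn.
by move=> k kn; have := cw k kn; lia.
Qed.

(** The random variable in the expectation is a series of weighted indicators
    of the disjoint events [passage_event n j]; their total probability is at
    most 1, so the expectation is finite and [fine] loses nothing. *)
Lemma passage_matrix_cvg (v : R) : 0 <= v <= 1 ->
  mx_series_cvg
    (fun n => v ^+ n.+1 *: exit_law (P := P) (X := X) (J := J) (fun y => y <= 0) n 1)
    (passage_matrix P X J v).
Proof.
move=> /andP[v0 v1] i j.
pose q n := fine (P i (passage_event n j)).
have qE n : P i (passage_event n j) = (q n)%:E.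
  by rewrite fineK // fin_num_measure //; exact: passage_event_measurable.
have q0 n : 0 <= q n by rewrite -lee_fin -qE.
have u0 n : 0 <= v ^+ n * q n by rewrite mulr_ge0 // exprn_ge0.
have bound : (\sum_(0 <= n <oo) (v ^+ n * q n)%:E <= 1)%E.
  apply: le_trans (_ : \sum_(0 <= n <oo) P i (passage_event n j) <= _)%E.
    apply: lee_nneseries => [n _ _|n _]; first by rewrite lee_fin.
    by rewrite qE lee_fin ler_piMl // exprn_ile1.
  have mU : measurable (\bigcup_n passage_event n j).
    by apply: bigcupT_measurable => n; exact: passage_event_measurable.
  rewrite -measure_semi_bigcup //; first exact: probability_le1.
    by move=> n; exact: passage_event_measurable.
  apply/trivIsetP => m n _ _ /eqP mn; apply/seteqP; split=> // w.
  by move=> [[e _] [e' _]]; apply: mn; move: e'; rewrite e => -[].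
have expE : ('E_(P i)[(fun w => if passage_time X w is Some n
                 then v ^+ n * (J n w == j)%:R else 0)%R] =
    \sum_(0 <= n <oo) (v ^+ n * q n)%:E)%E.
  rewrite unlock.
  transitivity (\int[P i]_w (\sum_(0 <= n <oo)
      (v ^+ n)%:E * (\1_(passage_event n j) w)%:E))%E.
    apply: eq_integral => w _.
    have [m um fm] : exists2 m,
        (forall n, n != m -> v ^+ n * \1_(passage_event n j) w = 0) &
        v ^+ m * \1_(passage_event m j) w =
        (if passage_time X w is Some n then v ^+ n * (J n w == j)%:R else 0).
      case e : (passage_time X w) => [m|]; last first.
        by exists 0%N => [n _|]; rewrite indicE memNset ?mulr0 // => -[]; rewrite e.
      exists m => [n nm|].
        rewrite indicE memNset ?mulr0 // => -[]; rewrite e => -[mn].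
        by rewrite mn eqxx in nm.
      rewrite indicE; case: eqP => Jm.
        by rewrite mem_set.
      by rewrite memNset // => -[].
    rewrite -fm; apply/esym/nonneg_series_cvgE; last exact: series_single_cvg.
    by move=> n; rewrite mulr_ge0 // exprn_ge0.
  rewrite integral_nneseries //; last first.
  - by move=> n w _; rewrite -EFinM lee_fin mulr_ge0 // exprn_ge0.
  - move=> n; apply: measurable_funeM; apply/measurable_EFinP.
    by apply: measurable_indic; exact: passage_event_measurable.
  apply: eq_eseriesr => n _.
  have mB := passage_event_measurable n j.
  rewrite ge0_integralZl_EFin //; last 2 first.
  - by apply/measurable_EFinP; exact: measurable_indic.
  - by rewrite exprn_ge0.
  by rewrite integral_indic // setIT EFinM; congr (_ * _)%E; exact: qE.
have fE : (\sum_(0 <= n <oo) (v ^+ n * q n)%:E)%E = (passage_matrix P X J v i j)%:E.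
  rewrite mxE expE fineK // ge0_fin_numE; first exact: le_lt_trans bound (ltry _).
  by apply: nneseries_ge0 => n _ _; rewrite lee_fin.
have /nonneg_series_cvgE -/(_ u0) h := fE.
(* passage takes at least one step, so the series starts at n = 1 *)
have u00 : v ^+ 0 * q 0%N = 0 by rewrite /q passage_event0 measure0 mulr0.
have eqs : (fun n => series (fun n => v ^+ n * q n) n.+1) =
    series (fun k => (v ^+ k.+1 *: exit_law (P := P) (X := X) (J := J)
                        (fun y => y <= 0) k 1) i j).
  apply/funext => n; rewrite /series /= big_nat_recl // u00 add0r.
  apply: eq_bigr => k _; rewrite [RHS]mxE; congr (_ * _).
  by rewrite /q measure_passage_event.
by rewrite -eqs (cvg_shiftS (series (fun n => v ^+ n * q n))).
Qed.

End PassageMatrix.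

Section Surplus.
Context {R : realType} {N : nat} {d : measure_display} {T : measurableType d}.
Context {Lam : nat -> 'M[R]_N} {P : 'I_N -> probability T R}.
Context {Z : nat -> T -> nat} {J : nat -> T -> 'I_N}.
Hypothesis hZ : modulated_sequence Lam P Z J.

Lemma surplusS u n w : surplus u Z n.+1 w = surplus u Z n w + (1 - (Z n.+1 w)%:Z).
Proof. by rewrite /surplus big_nat_recr //= intS; ring. Qed.

(** The claims become increments 1 - Z.  A history of increments with some value
    above 1 is empty, in accordance with [increment Lam m = 0] for m > 1; any other
    is a history of claims. *)
Lemma surplus_markov_additive :
  markov_additive_chain (increment Lam) P (surplus 0 Z) J.
Proof.
split; first by move=> w; rewrite /surplus big_geq.
have [mZ mJ P1 hstep] := hZ.
have dS n w : surplus 0 Z n.+1 w - surplus 0 Z n w = 1 - (Z n.+1 w)%:Z.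
  by rewrite surplusS addrC addKr.
have histE (x : nat -> int) s n :
    (forall k, (0 < k <= n)%N -> x k <= 1) ->
    history (fun n w => surplus 0 Z n w - surplus 0 Z n.-1 w) J x s n =
    history Z J (fun k => `|1 - x k|%N) s n.
  move=> x1; apply/seteqP; split=> w [hJ hx]; split=> // -[//|k] kn;
    have := hx k.+1 kn; have := x1 k.+1 kn; rewrite /= dS; lia.
have hist0 (x : nat -> int) s n k : (0 < k <= n)%N -> 1 < x k ->
    history (fun n w => surplus 0 Z n w - surplus 0 Z n.-1 w) J x s n = set0.
  move=> kn x1; apply/seteqP; split=> // w [hJ hx].
  by case: k kn x1 => [//|k] kn x1; have := hx k.+1 kn; rewrite /= dS; lia.
split=> // [n a|i n x s].
  have [a1|a1] := leP a 1.
    rewrite (_ : _ @^-1` _ = Z n.+1 @^-1` [set `|1 - a|%N]) //.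
    by apply/seteqP; split=> w /=; rewrite dS; lia.
  rewrite (_ : _ @^-1` _ = set0) //.
  by apply/seteqP; split=> // w /=; rewrite dS; lia.
have [hx|/existsNP [k /not_implyP [kn /negP]]] :=
    pselect (forall k, (0 < k <= n)%N -> x k <= 1); last first.
  rewrite -ltNge => xk.
  by rewrite (hist0 _ _ _ _ kn xk) (hist0 _ _ _ k) ?measure0 ?mul0e //; lia.
have [x1|x1] := leP (x n.+1) 1; last first.
  by rewrite (hist0 _ _ _ n.+1) ?leqnn // increment_gt1 // mxE mule0 measure0.
rewrite !histE //; last first.
  by move=> k kn; have [->//|nk] := eqVneq k n.+1; apply: hx; lia.
by rewrite hstep /increment x1.
Qed.

Lemma potentialE (v : R) (u x : nat) (i j : 'I_N) : (0 < u)%N -> (0 < x)%N ->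
  potential P Z J v u x i j =
  (\sum_(0 <= n <oo) (v ^+ n * walk Lam n u.-1 x.-1 i j)%:E)%E.
Proof.
move=> u0 x0; rewrite mxE; apply: eq_eseriesr => n _; rewrite EFinM; congr (_ * _)%E.
rewrite -(killed_law_walk _ _ _ surplus_markov_additive).
rewrite -(killed_lawE surplus_markov_additive); congr (P i _).
have sE k w : surplus u Z k w = u%:Z + surplus 0 Z k w by rewrite /surplus; ring.
apply/seteqP; split=> w.
  move=> [Ux Jn /before_first_time h]; split=> //; split.
    by move=> k kn; have := h k kn; rewrite sE; lia.
  by move: Ux; rewrite /= sE; lia.
move=> [[cw /= Xn] /= Jn]; split=> //; first by rewrite sE; lia.
by apply/before_first_time => k kn; have := cw k kn; rewrite sE; lia.
Qed.

End Surplus.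

(** * The recursion of the scale matrices *)

Section ScaleRecursion.
Context {R : realType} {N : nat}.
Variables (Lam : nat -> 'M[R]_N) (v : R) (W : int -> 'M[R]_N).
Hypothesis hLam : claim_kernel Lam.
Hypothesis v0 : 0 < v.
Hypothesis hW : is_scale_matrix (increment Lam) v W.

Lemma mx_series_single_cvg m (C : 'M[R]_N) :
  mx_series_cvg (fun n => (n == m)%:R *: C) C.
Proof.
move=> i j; set u := fun k => _.
have -> : C i j = u m by rewrite /u mxE eqxx mul1r.
by apply: series_single_cvg => n /negbTE nm; rewrite /u mxE nm mul0r.
Qed.

Lemma claim_kernel_cvg : mx_series_cvg Lam (mx_series Lam).
Proof.
have [L0 L1] := hLam; move=> i j; rewrite mxE.
have : cvgn (series (fun m => Lam m i j)); last by [].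
apply: series_le_cvg (cvgP _ (L1 i)) => n //.
  by apply: sumr_ge0 => k _.
by rewrite (bigD1 j) //= lerDl sumr_ge0.
Qed.

(** The Taylor coefficients of z (v F(z) - I), which is regular at 0. *)
Let B k := v *: Lam k - (k == 1%N)%:R *: 1%:M.

Lemma scale_symbol_cvg (z : R) : `|z| < 1 ->
  (forall i j, cvgn (series (fun k => `|(z ^+ k *: B k) i j|))) /\
  mx_series_cvg (fun k => z ^+ k *: B k) (mx_series (fun k => z ^+ k *: B k)).
Proof.
move=> z1.
have Bcvg : mx_series_cvg B (v *: mx_series Lam - 1%:M).
  apply: mx_series_cvgB; last exact: mx_series_single_cvg.
  by apply: mx_series_cvgZ; exact: claim_kernel_cvg.
have abs i j : cvgn (series (fun k => `|(z ^+ k *: B k) i j|)).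
  have B1 : cvgn (pseries (fun k => B k i j) 1).
    rewrite (_ : pseries _ 1 = series (fun k => B k i j)); last first.
      by apply/funext => n; apply: eq_bigr => k _ /=; rewrite expr1n mulr1.
    exact: cvgP (Bcvg i j).
  rewrite (_ : (fun k => _) = (fun k => `|B k i j| * `|z| ^+ k)); last first.
    by apply/funext => k; rewrite mxE normrM mulrC normrX.
  by apply: is_cvg_pseries_inside_norm B1 _; rewrite normr_id normr1.
split=> // i j; rewrite mxE.
have : cvgn (series (fun k => (z ^+ k *: B k) i j)); last by [].
by apply: normed_cvg; rewrite /normed_series_of /=; exact: abs.
Qed.

Lemma scale_symbolE (z : R) : `|z| < 1 -> z != 0 ->
  v *: genfun (increment Lam) z - 1%:M = z^-1 *: mx_series (fun k => z ^+ k *: B k).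
Proof.
move=> z1 z0; have [_ Mcvg] := scale_symbol_cvg z1.
set M := mx_series _ in Mcvg *.
have vn0 : v != 0 by rewrite gt_eqF.
suff -> : genfun (increment Lam) z = v^-1 *: (z^-1 *: M + 1%:M).
  by rewrite scalerA divff // scale1r addrK.
apply: mx_seriesE.
have := mx_series_cvgZ (c := v^-1)
  (mx_series_cvgD (mx_series_cvgZ (c := z^-1) Mcvg) (@mx_series_single_cvg 1 1%:M)).
congr mx_series_cvg; apply/funext => k.
rewrite (_ : - (k%:Z - 1) = 1 - k%:Z); last by rewrite opprB.
rewrite increment_1B scalerA -[z ^ _](_ : z^-1 * z ^+ k = _); last first.
  by rewrite expfzDr // mulrC.
rewrite /B scalerBr [_ *: (v *: _)]scalerA.
have [->|k1] := eqVneq k 1%N.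
  by rewrite expr1 mulVf // scale1r subrK scalerA mul1r mulVf // scale1r.
by rewrite !scale0r scaler0 subr0 addr0 scalerA mulrCA mulVf // mulr1.
Qed.

(** Both factors of (z (v F(z) - I)) (\sum_n z^n W(n)) = z I converge near 0,
    the first one absolutely, so their Cauchy product may be compared with z I
    coefficient by coefficient. *)
Lemma scale_coef (n : nat) :
  \sum_(k < n.+1) B k *m W (n - k)%N%:Z = (n == 1%N)%:R *: 1%:M.
Proof.
have [_ near_W] := hW.
apply/eqP; rewrite -subr_eq0; apply/eqP/matrixP => i j; rewrite [RHS]mxE.
move: n; apply: pseries0_coef; near=> z.
have z0 : z != 0 by near: z; exact: nbhs_dnbhs_neq.
have z1 : `|z| < 1.
  near: z; apply: dnbhs0_lt; exact: ltr01.
have [uM Wcvg] : v *: genfun (increment Lam) z - 1%:M \in unitmx /\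
     mx_series_cvg (fun n : nat => z ^+ n *: W n%:Z)
                   (invmx (v *: genfun (increment Lam) z - 1%:M)) by near: z.
have [abs Mcvg] := scale_symbol_cvg z1.
have := mx_cauchy_product_cvg abs Mcvg Wcvg.
have -> : mx_series (fun k => z ^+ k *: B k) *m
    invmx (v *: genfun (increment Lam) z - 1%:M) = z *: 1%:M.
  rewrite -[mx_series _](scalerKV z0) -scale_symbolE //.
  by rewrite -scalemxAl mulmxV.
move=> /mx_series_cvgB /(_ (@mx_series_single_cvg 1 (z *: 1%:M))).
rewrite subrr => /(_ i j); rewrite [X in _ --> X]mxE => h.
rewrite (_ : (fun m => _ * z ^+ m) = (fun m =>
  (\sum_(k < m.+1) z ^+ k *: B k *m (z ^+ (m - k) *: W (m - k)%N%:Z) -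
   (m == 1%N)%:R *: (z *: 1%:M)) i j)) //; apply/funext => m.
transitivity ((z ^+ m *: (\sum_(k < m.+1) B k *m W (m - k)%N%:Z -
  (m == 1%N)%:R *: 1%:M)) i j).
  by rewrite [RHS]mxE mulrC.
congr (fun_of_matrix _ i j); rewrite scalerBr scaler_sumr; congr (_ - _).
  apply: eq_bigr => k _; rewrite -scalemxAl -scalemxAr scalerA -exprD subnKC //.
  by rewrite -ltnS.
by rewrite !scalerA; case: eqVneq => [->|_]; rewrite ?mul0r ?mulr0 // expr1 mulrC.
Unshelve. all: by end_near.
Qed.

(** As W vanishes at the nonpositive integers, the convolution may be cut at any
    b >= n. *)
Lemma scale_recursion (n b : nat) : (n <= b)%N ->
  v *: \sum_(k < b) Lam k *m W (n%:Z - k%:Z) = W (n%:Z - 1) + (n == 1%N)%:R%:M.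
Proof.
move=> nB; have [W0 _] := hW.
have cut m : (n <= m)%N -> \sum_(k < m) Lam k *m W (n%:Z - k%:Z) =
    \sum_(k < n) Lam k *m W (n%:Z - k%:Z).
  elim: m => [|m IH]; first by rewrite leqn0 => /eqP ->.
  rewrite leq_eqVlt => /predU1P[<-//|nm].
  by rewrite big_ord_recr /= IH // W0 ?mulmx0 ?addr0 //; lia.
rewrite cut // -(cut n.+1) //.
have := scale_coef n; rewrite scalemx1 => <-.
under [X in _ = _ + X]eq_bigr do rewrite mulmxBl.
rewrite sumrB addrCA; apply/esym.
have -> : \sum_(k < n.+1) (nat_of_ord k == 1%N)%:R *: 1%:M *m W (n - k)%N%:Z = W (n%:Z - 1).
  case: n {nB cut} => [|n].
    by rewrite big_ord_recr big_ord0 /= scale0r mul0mx add0r W0.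
  rewrite (bigD1 (lift ord0 ord0 : 'I_n.+2)) //= scale1r mul1mx big1 ?addr0.
    by congr W; rewrite /bump /=; lia.
  move=> k k1; rewrite (_ : (nat_of_ord k == 1%N) = false) ?scale0r ?mul0mx //.
  by apply: contraNF k1 => /eqP e; apply/eqP/val_inj.
rewrite subrr addr0 scaler_sumr; apply: eq_bigr => k _.
rewrite -scalemxAl; congr (_ *: (_ *m W _)); have := ltn_ord k; lia.
Qed.

End ScaleRecursion.

(** * Positivity of the stationary law *)

Section StationaryPositive.
Context {R : realType} {N : nat}.

Lemma stationary_positive (Q : 'M[R]_N) (pi : 'rV[R]_N) :
  (forall i j, 0 <= Q i j) -> irreducible_mx Q -> stationary_distribution Q pi ->
  forall j, 0 < pi 0 j.
Proof.
move=> Q0 irr [pi0 pi1 piQ] j.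
have [i0 pii0] : exists i, 0 < pi 0 i.
  apply/existsP; apply: contraT => /existsPn h; exfalso.
  move: pi1; rewrite big1 => [/eqP|i _]; first by rewrite eq_sym oner_eq0.
  by apply/eqP; rewrite eq_le pi0 leNgt h.
have [n Qn] := irr i0 j.
have piQn : pi *m Q ^+ n = pi.
  elim: n {Qn} => [|n IH]; first by rewrite expr0 mulmx1.
  by rewrite exprSr mulmxA IH.
rewrite -piQn mxE (bigD1 i0) //= ltr_pwDl ?mulr_gt0 // sumr_ge0 // => k _.
by rewrite mulr_ge0 // expmx_ge0.
Qed.

Lemma diag_mx_unit (pi : 'rV[R]_N) : (forall j, 0 < pi 0 j) -> diag_mx pi \in unitmx.
Proof.
move=> p; rewrite unitmxE det_diag unitfE prodf_seq_neq0.
by apply/allP => j _; rewrite gt_eqF.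
Qed.

End StationaryPositive.

(** * The potential series *)

Section PotentialSeries.
Context {R : realType} {N : nat}.
Variables (Lam : nat -> 'M[R]_N) (v : R) (Rv : 'M[R]_N).
Hypothesis Lam0 : forall m i j, 0 <= Lam m i j.
Hypothesis uLam : Lam 0%N \in unitmx.
Hypothesis v0 : 0 < v.
Hypothesis Rv_cvg : mx_series_cvg (fun n => v ^+ n.+1 *: (Lam 0%N *m walk Lam n 0 0)) Rv.

(** The potential at the bottom level, K(0, 0), solved from
    Rv = v Lam(0) K(0, 0). *)
Let green0 : 'M[R]_N := v^-1 *: (invmx (Lam 0%N) *m Rv).

Let vn0 : v != 0. Proof. by rewrite gt_eqF. Qed.

Lemma green0_first_step : v *: Lam 0%N *m green0 = Rv.
Proof. by rewrite /green0 -scalemxAl -scalemxAr scalerA divff // scale1r mulKVmx. Qed.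

Lemma green0_cvg : mx_series_cvg (fun n => v ^+ n *: walk Lam n 0 0) green0.
Proof.
have := mx_series_cvgZ (c := v^-1) (mx_series_cvg_mulmxl (C := invmx (Lam 0%N)) Rv_cvg).
congr mx_series_cvg; apply/funext => n.
by rewrite -scalemxAr scalerA exprS mulKf // mulKmx.
Qed.

Lemma vwalk_ge0 n a b i j : 0 <= (v ^+ n *: walk Lam n a b) i j.
Proof. by rewrite mxE mulr_ge0 ?exprn_ge0 ?(ltW v0) // walk_ge0. Qed.

(** [walk_last_exit] is a Cauchy product: each further level costs one more
    factor v Lam(0) K(0, 0) = Rv. *)
Lemma potential_bottom_cvg b :
  mx_series_cvg (fun n => v ^+ n *: walk Lam n 0 b) (green0 *m Rv ^+ b).
Proof.
elim: b => [|b IH]; first by rewrite expr0 mulmx1; exact: green0_cvg.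
have := mx_cauchy_product_cvg
  (mx_series_nonneg_norm_cvg (fun n i j => vwalk_ge0 n 0 0 i j) green0_cvg)
  green0_cvg (mx_series_cvg_mulmxl (C := v *: Lam 0%N) IH).
rewrite (mulmxA (v *: Lam 0%N)) green0_first_step => h.
rewrite exprS -[_ *m (Rv * Rv ^+ b)]add0r.
(* the term n = 0 vanishes, which shifts the convolution into place *)
rewrite (_ : 0 = v ^+ 0 *: walk Lam 0 0 b.+1); last by rewrite /= raddf0 scaler0.
apply/(mx_series_cvg_shift (fun n => v ^+ n *: walk Lam n 0 b.+1) _).
move: h; congr mx_series_cvg; apply/funext => n.
rewrite walk_last_exit scaler_sumr; apply: eq_bigr => k _.
have kn : (k <= n)%N by rewrite -ltnS.
rewrite -!scalemxAl -!scalemxAr !scalerA !mulmxA; congr (_ *: _).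
by rewrite mulrCA -exprD subnKC // exprS.
Qed.

Lemma Rv_ge0 i j : 0 <= Rv i j.
Proof.
have term0 n k l : 0 <= (v ^+ n.+1 *: (Lam 0%N *m walk Lam n 0 0)) k l.
  rewrite mxE mulr_ge0 ?exprn_ge0 ?(ltW v0) //.
  by apply: mulmx_ge0 => // k' l'; exact: walk_ge0.
exact: le_trans (term0 0%N i j) (mx_series_cvg_ge _ _ _ term0 Rv_cvg).
Qed.

Lemma green0_ge_id (i j : 'I_N) : (i == j)%:R <= green0 i j.
Proof.
have := mx_series_cvg_ge 0%N i j (fun n i j => vwalk_ge0 n 0 0 i j) green0_cvg.
by rewrite expr0 scale1r /= mxE.
Qed.

(** The series \sum_n v^n walk (n+1) 0 0, conditioned on the level c before the
    last step and summed over n first. *)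
Lemma left_series_cvg :
  mx_series_cvg (fun c => green0 *m (Rv ^+ c *m Lam c.+1)) (v^-1 *: (green0 - 1%:M)).
Proof.
apply: (mx_series_cvg_swap
  (f := fun n c => v ^+ n *: (walk Lam n 0 c *m Lam c.+1))
  (Fr := fun n => v ^+ n *: walk Lam n.+1 0 0)).
- move=> n c i j; rewrite mxE mulr_ge0 ?exprn_ge0 ?(ltW v0) //.
  by apply: mulmx_ge0 => // k l; exact: walk_ge0.
- move=> n; rewrite (@walk_last _ _ _ _ _ _ n.+1) // scaler_sumr.
  rewrite (eq_bigr (fun c : 'I_n.+1 => v ^+ n *: (walk Lam n 0 c *m Lam c.+1))); last first.
    move=> c _; rewrite -[Lam c.+1]increment_1B; congr (_ *: (_ *m increment _ _)); lia.
  move=> i j; rewrite summxE; apply: cvg_near_cst; exists n.+1 => // B /= nB.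
  rewrite /series /= (@big_cat_nat _ _ _ n.+1) //= [X in _ + X]big1_seq ?addr0 ?big_mkord //.
  move=> c /andP[_]; rewrite mem_index_iota => /andP[nc _].
  by rewrite walk_far ?mul0mx ?scaler0 ?mxE.
- move=> c; rewrite mulmxA.
  have := mx_series_cvg_mulmxr (C := Lam c.+1) (@potential_bottom_cvg c).
  by congr mx_series_cvg; apply/funext => n; rewrite -scalemxAl.
have : mx_series_cvg (fun n => v ^+ n.+1 *: walk Lam n.+1 0 0) (green0 - 1%:M).
  apply/(mx_series_cvg_shift (fun n => v ^+ n *: walk Lam n 0 0) _).
  by rewrite expr0 scale1r /= addrC subrK; exact: green0_cvg.
move=> /(mx_series_cvgZ (c := v^-1)); congr mx_series_cvg; apply/funext => n.
by rewrite scalerA exprS mulKf.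
Qed.

(** [left_series_cvg] reads K(0,0) = I + v K(0,0) S with S the sum of the
    Rv^c Lam(c+1), once this sum is known to converge, which holds because K(0,0)
    dominates the identity; then K(0,0) (I - v S) = I gives the invertibility
    of K(0,0), hence of Rv = v Lam(0) K(0,0), and division by K(0,0) the
    equation. *)
Lemma potential_left_solution : is_left_solution (increment Lam) v Rv.
Proof.
have Scvg : mx_series_cvg (fun c => Rv ^+ c *m Lam c.+1)
    (mx_series (fun c => Rv ^+ c *m Lam c.+1)).
  apply: mx_series_cvg_dominated left_series_cvg => c i j.
  have X0 k l : 0 <= (Rv ^+ c *m Lam c.+1) k l.
    by apply: mulmx_ge0 => // ? ?; apply: expmx_ge0; exact: Rv_ge0.
  rewrite X0 /= [leRHS]mxE (bigD1 i) //= ler_wpDr //.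
    apply: sumr_ge0 => k _; rewrite mulr_ge0 // (le_trans _ (green0_ge_id i k)) //.
  by apply: ler_peMl => //; have := green0_ge_id i i; rewrite eqxx.
set S := mx_series _ in Scvg.
have HS : green0 *m S = v^-1 *: (green0 - 1%:M).
  exact: mx_series_cvg_unique (mx_series_cvg_mulmxl Scvg) left_series_cvg.
have H1 : green0 *m (1%:M - v *: S) = 1%:M.
  by rewrite mulmxBr mulmx1 -scalemxAr HS scalerA divff // scale1r subKr.
have [uH _] := mulmx1_unit H1.
have uM : Rv \in unitmx by rewrite -green0_first_step unitmx_mul unitmxZ ?unitfE // uLam.
split=> //.
have SE : invmx Rv *m Lam 0%N + S = (v^-1)%:M.
  have -> : S = v^-1 *: (1%:M - invmx green0).
    by rewrite -[S](mulKmx uH) HS -scalemxAr mulmxBr mulVmx // mulmx1.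
  have -> : invmx Rv *m Lam 0%N = v^-1 *: invmx green0.
    rewrite -[X in _ *m X = _](mulmxK uH) -[Lam 0%N *m green0](scalerK vn0).
    by rewrite scalemxAl green0_first_step mulmxA -scalemxAr mulVmx // -scalemxAl mul1mx.
  by rewrite -scalerDr addrC subrK scalemx1.
rewrite -SE -[invmx Rv *m Lam 0%N]/(mx_pow_pred Rv 0 *m Lam 0%N).
rewrite -[Lam 0%N in X in mx_series_cvg _ X](increment_1B Lam 0).
have e (k : nat) : - (k%:Z - 1) = 1 - k%:Z by rewrite opprB.
under [X in mx_series_cvg X]funext do rewrite e.
apply/mx_series_cvg_shift.
by under [X in mx_series_cvg X]funext do rewrite increment_1B.
Qed.

(** Induction on the starting level a.  The right-hand side [Tm] obeys the
    first-step recursion of the potential because of [scale_recursion]; at a = 0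
    both agree since W(1) = (v Lam(0))^-1, and the recursion, solved for
    the level a + 1, which Lam(0) being invertible permits, carries both
    convergence and value upwards. *)
Lemma potential_cvg (W : int -> 'M[R]_N) (a b : nat) :
  claim_kernel Lam -> is_scale_matrix (increment Lam) v W ->
  mx_series_cvg (fun n => v ^+ n *: walk Lam n a b)
    (W (a.+1%:Z) *m Rv ^+ b.+1 - W (a%:Z - b%:Z)).
Proof.
move=> hLam hW; have [W0 _] := hW.
have srec := scale_recursion hLam v0 hW.
have uvLam : v *: Lam 0%N \in unitmx by rewrite unitmxZ ?unitfE.
pose Tm (a : nat) := W (a.+1%:Z) *m Rv ^+ b.+1 - W (a%:Z - b%:Z).
(* m = a' + 2 serves the sum of the W(c+1), m = a' + 1 - b that of the W(c-b) *)
have recur (a' : nat) (m : nat) : (m <= a'.+2)%N ->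
    v *: \sum_(c < a'.+2) increment Lam (c%:Z - a'%:Z) *m W (m%:Z - a'.+1%:Z + c%:Z) =
    W (m%:Z - 1) + (m == 1%N)%:R%:M.
  move=> ma; rewrite -(srec _ _ ma) [in RHS](reindex_inj rev_ord_inj) /=.
  congr (_ *: _); apply: eq_bigr => c _; have ca := ltn_ord c.
  rewrite -increment_1B; congr (increment _ _ *m W _); lia.
have Trec (a' : nat) : Tm a' = (a' == b)%:R%:M +
    v *: \sum_(c < a'.+2) increment Lam (c%:Z - a'%:Z) *m Tm c.
  have -> : v *: \sum_(c < a'.+2) increment Lam (c%:Z - a'%:Z) *m Tm c =
    (v *: \sum_(c < a'.+2) increment Lam (c%:Z - a'%:Z) *m W (c.+1%:Z)) *m Rv ^+ b.+1 -
    v *: \sum_(c < a'.+2) increment Lam (c%:Z - a'%:Z) *m W (c%:Z - b%:Z).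
    rewrite -scalemxAl mulmx_suml -scalerBr -sumrB; congr (_ *: _).
    by apply: eq_bigr => c _; rewrite mulmxBr mulmxA.
  have -> : v *: \sum_(c < a'.+2) increment Lam (c%:Z - a'%:Z) *m W (c.+1%:Z) = W a'.+1%:Z.
    have := recur a' a'.+2 (leqnn _); rewrite raddf0 addr0.
    rewrite (_ : a'.+2%:Z - 1 = a'.+1%:Z); last by lia.
    move=> <-; congr (_ *: _); apply: eq_bigr => c _; congr (_ *m W _); lia.
  rewrite /Tm addrCA; congr (_ + _).
  have [ba|ab] := leqP b a'.+1; last first.
    rewrite W0; last by lia.
    rewrite big1 => [|c _]; last first.
      by rewrite W0 ?mulmx0 //; have := ltn_ord c; lia.
    by rewrite scaler0 neq_scalar_mx ?add0r //; apply/eqP; lia.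
  have := recur a' (a'.+1 - b)%N ltac:(lia).
  rewrite (_ : (a'.+1 - b)%N%:Z - 1 = a'%:Z - b%:Z); last by lia.
  rewrite (_ : ((a'.+1 - b)%N == 1%N) = (a' == b)); last by lia.
  move=> /eqP; rewrite -subr_eq => /eqP <-.
  rewrite opprB; congr (_ - _ *: _); apply: eq_bigr => c _; congr (_ *m W _); lia.
have W1 : W 1%:Z = invmx (v *: Lam 0%N).
  have := srec 1%N 1%N (leqnn _); rewrite big_ord1 /= subr0 subrr (W0 0) // add0r.
  by rewrite scalemxAl => h; rewrite -[W _](mulKmx uvLam) h mulmx1.
suff H c : (c <= a)%N ->
    mx_series_cvg (fun n => v ^+ n *: walk Lam n c b) (Tm c) by exact: H.
elim: a c => [|a' IH] c; [|rewrite leq_eqVlt ltnS => /predU1P[->|/IH//]].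
  rewrite leqn0 => /eqP ->; rewrite /Tm (W0 (0%:Z - b%:Z)); last by lia.
  rewrite subr0 W1 exprS mulmxA -{1}green0_first_step mulKmx //; exact: potential_bottom_cvg.
have := Trec a'; rewrite big_ord_recr /= => TE.
have := mx_series_cvg_sum (fun c : 'I_a'.+1 =>
   mx_series_cvg_mulmxl (C := increment Lam (c%:Z - a'%:Z)) (IH c (ltn_ord c))).
move=> hsum.
have hsh : mx_series_cvg (fun n => v ^+ n.+1 *: walk Lam n.+1 a' b)
    (Tm a' - (a' == b)%:R%:M).
  apply/(mx_series_cvg_shift (fun n => v ^+ n *: walk Lam n a' b) _).
  by rewrite expr0 scale1r /= addrC subrK; exact: IH.
have := mx_series_cvg_mulmxl (C := invmx (Lam 0%N))
  (mx_series_cvgB (mx_series_cvgZ (c := v^-1) hsh) hsum).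
have i1 : a'.+1%:Z - a'%:Z = 1 by lia.
congr mx_series_cvg.
  apply/funext => n; rewrite /= big_ord_recr /= i1 increment1 scalerA exprS mulKf //.
  rewrite scalerDr scaler_sumr.
  rewrite (eq_bigr (fun c : 'I_a'.+1 => increment Lam (c%:Z - a'%:Z) *m
    (v ^+ n *: walk Lam n c b))); last by move=> c' _; rewrite -scalemxAr.
  by rewrite [X in X - _]addrC addrK -scalemxAr mulKmx.
rewrite {1}TE addrAC subrr add0r scalerA mulVf // scale1r.
by rewrite [X in X - _]addrC addrK i1 increment1 mulKmx.
Qed.

End PotentialSeries.

(** * First passage of the reversed chain *)

Section ReturnSeries.
Context {R : realType} {N : nat} {d : measure_display} {T : measurableType d}.
Context {Lam : nat -> 'M[R]_N} {P : 'I_N -> probability T R}.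
Context {X : nat -> T -> int} {J : nat -> T -> 'I_N}.

(** The conjugation by diag(pi) and the transposition in [R_matrix] undo the time
    reversal: first passage above 0 at time n + 1 becomes a step up followed
    by n steps from 0 to 0 that stay nonnegative. *)
Lemma R_matrix_cvg (pi : 'rV[R]_N) (v : R) : diag_mx pi \in unitmx -> 0 <= v <= 1 ->
  markov_additive_chain (reversed_increment (increment Lam) pi) P X J ->
  mx_series_cvg (fun n => v ^+ n.+1 *: (Lam 0%N *m walk Lam n 0 0))
    (R_matrix pi P X J v).
Proof.
move=> uD v01 hX.
have skip m : 1 < m -> reversed_increment (increment Lam) pi m = 0.
  by move=> m1; rewrite /reversed_increment increment_gt1 // trmx0 mulmx0 mul0mx.
have exitE n : exit_law (P := P) (X := X) (J := J) (fun y => y <= 0) n 1 =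
    invmx (diag_mx pi) *m (Lam 0%N *m walk Lam n 0 0)^T *m diag_mx pi.
  rewrite (exit_law_step hX skip (phi := fun c : 'I_1 => 0)).
  - rewrite big_ord1 subr0 -[0]oppr0 (reversed_killed_law_walk _ 0 uD hX).
    by rewrite /reversed_increment increment1 trmx_mul !mulmxA mulmxK.
  - by move=> c c' _; rewrite !ord1.
  - move=> w gw cw Xw; exists ord0; have := gw n.+1; rewrite leqnn => /(_ isT) /= hj.
    by have := cw n (leqnn n); lia.
have h := passage_matrix_cvg hX skip v01.
have ht : mx_series_cvg (fun n => (v ^+ n.+1 *: exit_law (P := P) (X := X) (J := J)
    (fun y => y <= 0) n 1)^T) (passage_matrix P X J v)^T.
  by move=> i j; rewrite mxE; under [X in series X]funext do rewrite mxE; exact: h.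
have := mx_series_cvg_mulmxr (C := diag_mx pi)
  (mx_series_cvg_mulmxl (C := invmx (diag_mx pi)) ht).
congr mx_series_cvg; apply/funext => n.
rewrite exitE linearZ /= -scalemxAr -scalemxAl; congr (_ *: _).
set C := _ *m walk _ _ _ _.
rewrite !(trmx_mul _ (diag_mx pi), trmx_mul _ C^T) trmxK trmx_inv tr_diag_mx.
by rewrite mulKmx // mulmxKV.
Qed.

End ReturnSeries.

(** * The potential of the risk process *)

Theorem theorem5 (R : realType) (N : nat)
    (Lam : nat -> 'M[R]_N) (pi : 'rV[R]_N)
    (d : measure_display) (T : measurableType d)
    (P : 'I_N -> probability T R)
    (Z : nat -> T -> nat) (J : nat -> T -> 'I_N)
    (dt : measure_display) (Tt : measurableType dt)
    (Pt : 'I_N -> probability Tt R)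
    (Xt : nat -> Tt -> int) (Jt : nat -> Tt -> 'I_N)
    (v : R) (W : int -> 'M[R]_N) (u x : nat)
    (hLam : claim_kernel Lam)
    (hirr : irreducible_mx (mx_series Lam))
    (hpi : stationary_distribution (mx_series Lam) pi)
    (hZJ : modulated_sequence Lam P Z J)
    (hmean : finite_mean_claims P Z J)
    (hA1 : increment Lam 1 \in unitmx)
    (hnet : net_profit (increment Lam) pi)
    (hrev : markov_additive_chain
              (reversed_increment (increment Lam) pi) Pt Xt Jt)
    (hv : 0 < v <= 1) (hu : (0 < u)%N) (hx : (0 < x)%N)
    (hW : is_scale_matrix (increment Lam) v W) :
  let Rv := R_matrix pi Pt Xt Jt v in
  is_left_solution (increment Lam) v Rv /\
  potential P Z J v u x =
    map_mx EFin (W u%:Z *m Rv ^+ x - W (u%:Z - x%:Z)).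
Proof.
move=> Rv; case/andP: hv => v0 v1; rewrite increment1 in hA1.
have [Lam0 _] := hLam.
have P0 i j : 0 <= mx_series Lam i j.
  exact: le_trans (Lam0 0%N i j) (mx_series_cvg_ge _ _ _ Lam0 (claim_kernel_cvg hLam)).
have uD := diag_mx_unit (stationary_positive P0 hirr hpi).
have Rcvg : mx_series_cvg (fun n => v ^+ n.+1 *: (Lam 0%N *m walk Lam n 0 0)) Rv.
  by apply: R_matrix_cvg => //; rewrite (ltW v0).
split; first exact: potential_left_solution.
case: u hu => [//|a] _; case: x hx => [//|b] _.
apply/matrixP => i j; rewrite (potentialE hZJ) // [RHS]mxE.
have H := potential_cvg Lam0 hA1 v0 Rcvg (a := a) (b := b) hLam hW.
rewrite (_ : a.+1%:Z - b.+1%:Z = a%:Z - b%:Z); last by lia.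
apply/nonneg_series_cvgE => [n|]; first by rewrite mulr_ge0 ?exprn_ge0 ?(ltW v0) // walk_ge0.
by have := H i j; under [X in series X]funext do rewrite mxE.
Qed.
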